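(* (Theorem of $\mathrm{ZFC} + \mathrm{MA}$.) Suppose that $M$ is a countable non-standard model of $\mathrm{PA}$, that $\mathcal{A} \subset 2^\omega$ is of cardinality $< 2^\omega$, and that $\mathcal{B} \subset 2^\omega$ is countable and such that the Turing ideal generated by $\mathrm{SSy}(M) \cup \mathcal{B}$ is disjoint from $\mathcal{A}$. Then there exists a family $(M_{\mathcal{X}} : \mathcal{X} \subseteq 2^\omega)$, indexed by all subsets $\mathcal{X}$ of $2^\omega$, such that for every $\mathcal{X} \subseteq 2^\omega$: $M \prec M_{\mathcal{X}}$, $\mathcal{B} \subseteq \mathrm{SSy}(M_{\mathcal{X}})$, and $$|M_{\mathcal{X}}| = |\mathrm{SSy}(M_{\mathcal{X}})| = \max\{\omega, |\mathcal{X}|\};$$ and for all $\mathcal{X}, \mathcal{Y} \subseteq 2^\omega$ $$\mathcal{X} \subseteq \mathcal{Y} \iff M_{\mathcal{X}} \preceq M_{\mathcal{Y}} \iff \mathrm{SSy}(M_{\mathcal{X}}) \subseteq \mathrm{SSy}(M_{\mathcal{Y}}).$$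
   Context: $\mathrm{MA}$ is Martin's Axiom, assumed in addition to $\mathrm{ZFC}$. $\mathrm{PA}$ is first-order Peano arithmetic; a model of $\mathrm{PA}$ is non-standard if it is not (isomorphic to) the standard model $\mathbb{N}$, and $\omega$, the set of standard natural numbers, is identified with the standard initial segment of any model. Subsets of $\omega$ are identified with their characteristic functions, i.e. with elements of $2^\omega$; when used as a cardinal, $2^\omega$ is the continuum. For $M \models \mathrm{PA}$ non-standard, each $b \in M$ is regarded as a binary sequence with $i$-th bit $(b)_i$. An element $b \in M - \omega$ codes the set $\{i \in \omega : M \models (b)_i = 1\}$. The standard system $\mathrm{SSy}(M)$ is the collection of subsets of $\omega$ coded by some $b \in M - \omega$; equivalently, the collection of all intersections of $\omega$ with definable subsets of $M$. $M \preceq M'$ and $M \prec M'$ mean that $M'$ is an elementary extension of $M$. A Turing ideal is a collection $\mathcal{S}$ of subsets of $\omega$ such that $X \oplus Y = 2X \cup (2Y+1) \in \mathcal{S}$ whenever $X, Y \in \mathcal{S}$, and $Y \in \mathcal{S}$ whenever $Y$ is recursive in some $X \in \mathcal{S}$. The Turing ideal generated by a collection is the smallest Turing ideal containing it. *)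

(* Defs.v *)
From mathcomp Require Import all_boot all_order.
From mathcomp Require Import boolp classical_sets functions cardinality.

Set Implicit Arguments.
Unset Strict Implicit.
Unset Printing Implicit Defensive.

Local Open Scope classical_set_scope.
Local Open Scope card_scope.

Definition card_lt T U (A : set T) (B : set U) : Prop :=
  A #<= B /\ ~ (B #<= A).

Definition card_eq_max T U V (C : set V) (A : set T) (B : set U) : Prop :=
  if A #<= B then C #= B else C #= A.

(* [2^omega] is [set nat]; as a cardinal it is that of [[set: set nat]]. *)
Definition continuum : set (set nat) := setT.

Section Forcing.
Context (d : Order.disp_t) (P : porderType d).

Definition compatible (p q : P) : Prop :=
  exists r : P, (r <= p)%O /\ (r <= q)%O.

Definition antichain (A : set P) : Prop :=
  forall p q, A p -> A q -> p <> q -> ~ compatible p q.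

Definition ccc : Prop := forall A : set P, antichain A -> countable A.

Definition dense_subset (D : set P) : Prop :=
  forall p : P, exists q, D q /\ (q <= p)%O.

Definition order_filter (G : set P) : Prop :=
  [/\ G !=set0,
      forall p q : P, G p -> (p <= q)%O -> G q &
      forall p q : P, G p -> G q -> exists r, [/\ G r, (r <= p)%O & (r <= q)%O]].

End Forcing.

Definition martin_axiom : Prop :=
  forall (d : Order.disp_t) (P : porderType d),
    [set: P] !=set0 -> ccc P ->
    forall DD : set (set P),
      card_lt DD continuum -> (forall D, DD D -> dense_subset D) ->
      exists G : set P, order_filter G /\ forall D, DD D -> G `&` D !=set0.

(* De Bruijn indices: [Var 0] is bound by the innermost [All]. *)
Inductive term :=
  | Var of nat
  | Zero
  | Succ of term
  | Add of term & term
  | Mul of term & term.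

Inductive formula :=
  | Eq of term & term
  | Bot
  | Imp of formula & formula
  | All of formula.

(* The universe of a structure is a subset [dom] of an ambient type, so that
   "substructure" is literal inclusion.  The operations are irrelevant outside
   [dom]. *)
Record structure (U : Type) := Structure {
  dom : set U;
  zero : U;
  succ : U -> U;
  add : U -> U -> U;
  mul : U -> U -> U;
  dom_zero : dom zero;
  dom_succ : forall x, dom x -> dom (succ x);
  dom_add : forall x y, dom x -> dom y -> dom (add x y);
  dom_mul : forall x y, dom x -> dom y -> dom (mul x y) }.

Definition standard_model : structure nat :=
  @Structure nat setT 0 S addn muln I (fun _ _ => I) (fun _ _ _ _ => I)
    (fun _ _ _ _ => I).

Definition isomorphic T U (M : structure T) (N : structure U) : Prop :=
  exists f : T -> U,
    [/\ set_bij (dom M) (dom N) f,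
        f (zero M) = zero N,
        forall x, dom M x -> f (succ M x) = succ N (f x),
        forall x y, dom M x -> dom M y ->
          f (add M x y) = add N (f x) (f y) &
        forall x y, dom M x -> dom M y ->
          f (mul M x y) = mul N (f x) (f y)].

Definition scons U (a : U) (v : nat -> U) (n : nat) : U :=
  if n is m.+1 then v m else a.

Section Semantics.
Context (U : Type) (M : structure U).

Fixpoint eval (v : nat -> U) (t : term) : U :=
  match t with
  | Var n => v n
  | Zero => zero M
  | Succ t => succ M (eval v t)
  | Add t u => add M (eval v t) (eval v u)
  | Mul t u => mul M (eval v t) (eval v u)
  end.

Fixpoint sat (v : nat -> U) (phi : formula) : Prop :=
  match phi with
  | Eq t u => eval v t = eval v u
  | Bot => False
  | Imp phi psi => sat v phi -> sat v psi
  | All phi => forall a, dom M a -> sat (scons a v) phi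
  end.

Definition assignment (v : nat -> U) : Prop := forall n, dom M (v n).

Record models_PA : Prop := ModelsPA {
  PA_succ_neq0 : forall x, dom M x -> succ M x <> zero M;
  PA_succ_inj : forall x y, dom M x -> dom M y ->
    succ M x = succ M y -> x = y;
  PA_add0 : forall x, dom M x -> add M x (zero M) = x;
  PA_addS : forall x y, dom M x -> dom M y ->
    add M x (succ M y) = succ M (add M x y);
  PA_mul0 : forall x, dom M x -> mul M x (zero M) = zero M;
  PA_mulS : forall x y, dom M x -> dom M y ->
    mul M x (succ M y) = add M (mul M x y) x;
  (* the first-order induction schema; [v] supplies the parameters *)
  PA_ind : forall (phi : formula) (v : nat -> U), assignment v ->
    sat (scons (zero M) v) phi ->
    (forall x, dom M x -> sat (scons x v) phi -> sat (scons (succ M x) v) phi) ->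
    forall x, dom M x -> sat (scons x v) phi }.

Definition nonstandard : Prop := ~ isomorphic standard_model M.

Definition numeral (n : nat) : U := iter n (succ M) (zero M).

Definition lt_in (x y : U) : Prop :=
  exists z, dom M z /\ add M x (succ M z) = y.

(* [M |= (b)_i = 1] for standard [i], where [(b)_i] is the [i]-th binary digit
   of [b], i.e. [b = (2 q + 1) 2^i + r] with [r < 2^i].  As [i] is standard,
   [2^i] is a numeral, and exponentiation inside [M] is not needed. *)
Definition bit1 (b : U) (i : nat) : Prop :=
  exists q r, [/\ dom M q, dom M r, lt_in r (numeral (2 ^ i)) &
    b = add M (mul M (succ M (add M q q)) (numeral (2 ^ i))) r].

Definition coded_set (b : U) : set nat := [set i | bit1 b i].

Definition SSy : set (set nat) :=
  [set X | exists b, [/\ dom M b, ~ range numeral b & X = coded_set b]].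

End Semantics.

(* [M] is an elementary submodel of [N]; that [M] is a substructure of [N] is
   the case of atomic formulas. *)
Definition elementary U (M N : structure U) : Prop :=
  dom M `<=` dom N /\
  forall (phi : formula) (v : nat -> U), assignment M v ->
    sat M v phi <-> sat N v phi.

Definition proper_elementary U (M N : structure U) : Prop :=
  elementary M N /\ dom M <> dom N.

Definition char_fun (X : set nat) (n : nat) : nat := `[< X n >].

(* The total functions recursive in [X]: the closure of the initial functions
   and [char_fun X] under composition, primitive recursion and minimization of
   regular functions. *)
Inductive recursive_fun (X : set nat) :
    forall k : nat, (k.-tuple nat -> nat) -> Prop :=
  | RecZero k : recursive_fun X (fun _ : k.-tuple nat => 0)
  | RecSucc : recursive_fun X (fun v : 1.-tuple nat => (thead v).+1)
  | RecProj k (i : 'I_k) : recursive_fun X (fun v : k.-tuple nat => tnth v i)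
  | RecOracle : recursive_fun X (fun v : 1.-tuple nat => char_fun X (thead v))
  | RecComp k m (f : m.-tuple nat -> nat) (g : 'I_m -> k.-tuple nat -> nat) :
      recursive_fun X f -> (forall i, recursive_fun X (g i)) ->
      recursive_fun X (fun v => f [tuple g i v | i < m])
  | RecPrim k (f : k.-tuple nat -> nat) (g : k.+2.-tuple nat -> nat) :
      recursive_fun X f -> recursive_fun X g ->
      recursive_fun X (fun v : k.+1.-tuple nat =>
        nat_rect (fun _ => nat) (f [tuple of behead v])
          (fun n r => g [tuple of n :: r :: [tuple of behead v]]) (thead v))
  | RecMin k (f : k.+1.-tuple nat -> nat) (h : k.-tuple nat -> nat) :
      recursive_fun X f ->
      (forall v, f [tuple of h v :: v] = 0 /\
         forall n, n < h v -> f [tuple of n :: v] <> 0) ->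
      recursive_fun X h.

Definition recursive_in (Y X : set nat) : Prop :=
  recursive_fun X (fun v : 1.-tuple nat => char_fun Y (thead v)).

Definition join (X Y : set nat) : set nat :=
  [set n.*2 | n in X] `|` [set n.*2.+1 | n in Y].

Definition turing_ideal (S : set (set nat)) : Prop :=
  (forall X Y, S X -> S Y -> S (join X Y)) /\
  (forall X Y, S X -> recursive_in Y X -> S Y).

Definition generated_turing_ideal (S : set (set nat)) : set (set nat) :=
  smallest turing_ideal S.

(* Main.v *)
Require Import Defs.
From mathcomp Require Import all_boot all_order.
From mathcomp Require Import boolp classical_sets functions cardinality filter.
From mathcomp Require Import zify.

(* [zero], [succ], [add] and [mul] below are the operations of a structure. *)
Import Defs.

Set Implicit Arguments.
Unset Strict Implicit.
Unset Printing Implicit Defensive.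

Local Open Scope classical_set_scope.
Local Open Scope card_scope.

(** Fix an ultrafilter [W] on omega that contains the cofinite sets.  Every
model of the family lives inside the ultrapower of [M] by [W]: [N X] consists
of the classes of the sequences that arise, stage by stage, by applying Skolem
functions of [M] to constants, to codes of singletons and of the members of
[B], and to one generator [fun j => numeral (gen j x)] for each [x] in [X].
Such a hull satisfies the theorem of Los ([Los]), so [X `<=` Y] makes [N X] an
elementary submodel of [N Y], and then [SSy (N X)] is included in [SSy (N Y)].
Sequences of standard numbers whose digits stabilize to [b] put every [b] of
[B] into the standard system ([padded_code_trace]).

What remains is to recover [X] from [SSy (N X)].  The digits of the generator
at [x] converge along [W] to a real [generic x], and [gen] has to be such that
[generic x] is not in [SSy (N Y)] unless [x] is in [Y].  An element of [N Y] is
at stage [j] the value of one of countably many functions at the numbers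
[gen j y_1, ..., gen j y_n]; so it is enough that for each of these functions
and all [x] distinct from [y_1, ..., y_n] there be a standard [m] such that, at
almost every stage, the first [m] digits of [gen j x] differ from the first [m]
digits of that value.  It matters that [m] does not depend on [j].

A stage is a finite problem.  At stage [j] the number [gen j x] depends only on
which of [j] buckets contains [x] ([bucket]); passing from [k] to [k.+1]
buckets splits a single bucket, and distinct reals are eventually separated.
The requirements of level [k <= j] concern reals that lie in distinct
buckets of the level [k], the first [k] functions, and digits below
[precision k].  To meet them all, choose numbers below [2 ^ n] uniformly at
random.  If a proportion [d] of the configurations of [k] numbers is good, then
splitting a bucket amounts to duplicating one coordinate and asking that both
versions be good, which by the Cauchy-Schwarz inequality still has probability
at least [d ^ 2] ([card_clone]); and a single new requirement fails with
probability at most [2 ^ - m] ([card_congruent]), because the value to be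
avoided does not depend on the coordinate that must avoid it.  A large [m],
chosen in terms of [k] only, keeps a positive proportion good ([card_good]).

For the cardinalities, an element of [N X] is determined by one of countably
many skeletons of Skolem terms and a finite list of members of [X]
([card_dom_nat_seq]), and there are [max(omega, |X|)] such pairs because an
infinite set is equinumerous with its square ([exists_pairing]).  Conversely
[generic] embeds [X] into [SSy (N X)], and the codes of singletons embed
omega. *)

(** * Averaging over finite powers *)

Section Averaging.
Variables (I V : finType).
Implicit Types (c : {ffun I -> V}) (i k p : I).

Definition fupd c i (b : V) : {ffun I -> V} :=
  [ffun x => if x == i then b else c x].

Lemma fupdE c i b x : fupd c i b x = if x == i then b else c x.
Proof. by rewrite ffunE. Qed.

(** Averaging first over one coordinate does not change a mean: exchanging [b]
with the overwritten value is an involution on pairs [(c, b)]. *)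
Lemma sum_fupd i (h : {ffun I -> V} -> nat) :
  \sum_c \sum_b h (fupd c i b) = #|V| * \sum_c h c.
Proof.
pose swap (u : {ffun I -> V} * V) := (fupd u.1 i u.2, u.1 i).
have swapK : involutive swap.
  case=> c b; rewrite /swap /= fupdE eqxx; congr (_, _).
  by apply/ffunP=> x; rewrite !fupdE; case: (eqVneq x i) => [->|].
rewrite pair_big /= (reindex_inj (inv_inj swapK)) /=.
rewrite (eq_bigr (fun u : {ffun I -> V} * V => h u.1)); last first.
  move=> u _; congr h; apply/ffunP=> x; rewrite !fupdE.
  by case: (eqVneq x i) => [->|].
rewrite -(pair_big xpredT xpredT (fun c (_ : V) => h c)) /=.
rewrite big_distrr /=; apply: eq_bigr => c _.
by rewrite sum_nat_const.
Qed.

Lemma Cauchy_sum (T : finType) (g : T -> nat) :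
  (\sum_x g x) ^ 2 <= #|T| * \sum_x g x ^ 2.
Proof.
rewrite -(leq_pmul2l (isT : 0 < 2)).
have -> : 2 * (\sum_x g x) ^ 2 = \sum_x \sum_y 2 * (g x * g y).
  rewrite expnS expn1 big_distrl /= big_distrr /=; apply: eq_bigr => x _.
  by rewrite -big_distrr /= -big_distrr.
have -> : 2 * (#|T| * \sum_x g x ^ 2) = \sum_x \sum_y (g x ^ 2 + g y ^ 2).
  under [RHS]eq_bigr => x _ do rewrite big_split /= sum_nat_const.
  by rewrite big_split /= -big_distrr /= sum_nat_const mul2n addnn.
by apply: leq_sum => x _; apply: leq_sum => y _; exact: nat_Cauchy.
Qed.

(** If a proportion [d] of all [c] satisfies [D], then a proportion at least
[d ^ 2] still does after its coordinate [p] is replaced by the independent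
coordinate [k].  With [g c] the number of values at [p] that put [c] into [D],
the two events together count the second moment of [g], and [#|D|] is its
first moment. *)
Lemma card_clone (D : pred {ffun I -> V}) p k : p != k ->
  (forall c b, D (fupd c k b) = D c) ->
  #|D| ^ 2 <= #|{ffun I -> V}| * #|[pred c | D c && D (fupd c p (c k))]|.
Proof.
move=> pk Dk.
have [V0|V0] := posnP #|V|.
  have Ot c : D c = false by case: (fintype0 (c p)).
  by rewrite (eq_card0 (A := D)) // => c; rewrite inE Ot.
set E := #|[pred c | _ && _]|.
pose g c := \sum_b D (fupd c p b).
have gp c b : g (fupd c p b) = g c.
  apply: eq_bigr => b' _; congr (nat_of_bool (D _)).
  by apply/ffunP=> x; rewrite !fupdE; case: eqP.
have sg : \sum_c g c = #|V| * #|D|.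
  rewrite (sum_fupd p (fun c => D c : nat)); congr (_ * _).
  by rewrite -sum1_card [RHS]big_mkcond.
have sg2 : \sum_c g c ^ 2 = #|V| ^ 2 * E.
  (* [g] does not depend on the coordinate [p], so one factor averages to [D] *)
  transitivity (#|V| * \sum_c D c * g c).
    rewrite -(sum_fupd p); apply: eq_bigr => c _.
    under eq_bigr => b _ do rewrite gp.
    by rewrite -big_distrl.
  rewrite expnS expn1 -mulnA; congr (_ * _).
  transitivity (\sum_c \sum_b
      (D (fupd c k b) && D (fupd (fupd c k b) p (fupd c k b k)) : nat)).
    apply: eq_bigr => c _; rewrite /g big_distrr /=; apply: eq_bigr => b _.
    rewrite Dk mulnb fupdE eqxx; congr (nat_of_bool (_ && _)).
    rewrite -(Dk (fupd c p b) b); congr D; apply/ffunP=> x; rewrite !fupdE.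
    by case: (eqVneq x k) => // ->; rewrite eq_sym (negPf pk).
  rewrite (sum_fupd k (fun c => D c && D (fupd c p (c k)) : nat)).
  by congr (_ * _); rewrite /E -sum1_card [RHS]big_mkcond.
have := Cauchy_sum g; rewrite sg sg2 expnMn mulnCA leq_pmul2l //.
by rewrite expn_gt0 V0.
Qed.

End Averaging.

(** A residue computed from the other coordinates is hit by the coordinate [i]
with probability [2 ^ - m]. *)
Lemma card_congruent (I : finType) (n m : nat) (i : I)
    (F : {ffun I -> 'I_(2 ^ n)} -> nat) : m <= n ->
  (forall c b, F (fupd c i b) = F c) ->
  2 ^ m * #|[pred c : {ffun I -> 'I_(2 ^ n)} | c i %% 2 ^ m == F c]|
    <= #|{ffun I -> 'I_(2 ^ n)}|.
Proof.
move=> mn Fi; set E := #|_|.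
have hE : 2 ^ n * E = \sum_c \sum_(b : 'I_(2 ^ n)) (b %% 2 ^ m == F c : nat).
  transitivity (\sum_(c : {ffun I -> 'I_(2 ^ n)}) \sum_(b : 'I_(2 ^ n))
      (fupd c i b i %% 2 ^ m == F (fupd c i b) : nat)).
    rewrite (sum_fupd i (fun c : {ffun I -> 'I_(2 ^ n)} =>
      c i %% 2 ^ m == F c : nat)) card_ord; congr (_ * _).
    by rewrite /E -sum1_card [LHS]big_mkcond.
  by apply: eq_bigr => c _; apply: eq_bigr => b _; rewrite fupdE eqxx Fi.
have {}hE : 2 ^ n * E <= #|{ffun I -> 'I_(2 ^ n)}| * 2 ^ (n - m).
  rewrite hE -sum_nat_const; apply: leq_sum => c _.
  have quo (b : 'I_(2 ^ n)) : b %/ 2 ^ m < 2 ^ (n - m).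
    by rewrite ltn_divLR ?expn_gt0 // -expnD subnK.
  pose q (b : 'I_(2 ^ n)) : 'I_(2 ^ (n - m)) := Ordinal (quo b).
  have -> : \sum_(b : 'I_(2 ^ n)) (b %% 2 ^ m == F c : nat) =
      #|[pred b : 'I_(2 ^ n) | b %% 2 ^ m == F c]|.
    by rewrite -sum1_card [RHS]big_mkcond.
  rewrite -[X in _ <= X](card_ord (2 ^ (n - m))).
  rewrite -(@card_in_image _ _ q); first exact: max_card.
  move=> b b' /eqP hb /eqP hb' [qq]; apply: val_inj => /=.
  by rewrite (divn_eq b (2 ^ m)) (divn_eq b' (2 ^ m)) hb hb' qq.
have := hE; rewrite -{1}(subnK mn) expnD -mulnA mulnC leq_pmul2r ?expn_gt0 //.
Qed.

(** * Good configurations of numbers *)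

Definition upd (c : nat -> nat) (p b : nat) : nat -> nat :=
  fun x => if x == p then b else c x.

(** The bucket that is split to create the bucket [k], as in linear hashing:
[k] without its leading binary digit. *)
Definition parent (k : nat) : nat := k - 2 ^ trunc_log 2 k.

(** The requirements of level [k]: modulo [2 ^ m], no entry of [c] below [k]
is the value of one of the first [k] functions at [k] entries with other
indices.  Here [F l v] stands for the residue of the [l]-th function. *)
Definition avoiding (m : nat) (F : nat -> seq nat -> nat) (k : nat)
    (c : nat -> nat) : bool :=
  [forall l : 'I_k, forall i : 'I_k, forall s : k.-tuple 'I_k,
    (i \notin s) ==>
      (c i %% 2 ^ m != F l [seq c (nat_of_ord x) | x <- s])].

(** The duplicated configuration must be good as well: later on the new entry
[k'] may take over the role that its parent had at the level [k']. *)
Fixpoint good (m : nat -> nat) (F : nat -> nat -> seq nat -> nat) (k : nat)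
    (c : nat -> nat) : bool :=
  if k is k'.+1 then
    [&& good m F k' c, good m F k' (upd c (parent k') (c k'))
      & avoiding (m k) (F (m k)) k c]
  else true.

Lemma parent_lt k : 0 < k -> parent k < k.
Proof. by move=> k0; rewrite /parent; have := expn_gt0 2 (trunc_log 2 k); lia. Qed.

Lemma parent_le k : parent k <= k.
Proof. exact: leq_subr. Qed.

Lemma eq_avoiding m F k c c' : (forall x, x < k -> c x = c' x) ->
  avoiding m F k c = avoiding m F k c'.
Proof.
move=> cc; apply: eq_forallb => l; apply: eq_forallb => i.
apply: eq_forallb => s; rewrite cc //; congr (_ ==> (_ != F _ _)).
by apply: eq_map => x; apply: cc.
Qed.

Lemma eq_good m F k c c' : (forall x, x < k -> c x = c' x) ->
  good m F k c = good m F k c'.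
Proof.
elim: k c c' => //= k IH c c' cc.
rewrite (IH c c'); last by move=> x xk; apply: cc; lia.
rewrite (eq_avoiding _ _ cc) (IH (upd c _ _) (upd c' (parent k) (c' k))) //.
by move=> x xk; rewrite /upd; case: eqP => _; apply: cc; lia.
Qed.

(** [1 / sparsity k] is a lower bound for the proportion of configurations that
are good at the level [k]: one duplication squares it, and the new requirements
cost at most half of the rest. *)
Fixpoint sparsity (k : nat) : nat :=
  if k is k'.+1 then 2 * sparsity k' ^ 2 else 1.

(** There are [k * (k * k ^ k)] requirements of level [k], one for each
function, index and list of arguments; at this precision they fail together
with probability at most [1 / sparsity k]. *)
Definition precision (k : nat) : nat := sparsity k * (k * (k * k ^ k)).

Section Density.
Variables (J n : nat) (F : nat -> nat -> seq nat -> nat).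
Hypothesis precise : forall k, k <= J.+1 -> precision k <= n.
Notation Omega := {ffun 'I_J.+1 -> 'I_(2 ^ n)}.

Let ext (f : Omega) (x : nat) : nat := f (inord x).

Lemma ext_fupd f x b : x < J.+1 ->
  {in [pred y | y < J.+1], ext (fupd f (inord x) b) =1 upd (ext f) x b}.
Proof.
move=> xJ y; rewrite inE => yJ; rewrite /ext /upd fupdE.
rewrite -(inj_eq val_inj) /= !inordK //.
by case: eqP.
Qed.

Lemma card_not_avoiding k : k <= J.+1 ->
  2 ^ precision k
     * #|[pred f : Omega | ~~ avoiding (precision k) (F (precision k)) k (ext f)]|
    <= k * (k * k ^ k) * #|Omega|.
Proof.
move=> kJ; set m := precision k.
pose clash (l i : 'I_k) (s : k.-tuple 'I_k) (f : Omega) :=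
  (i \notin s) &&
     (ext f i %% 2 ^ m == F m l [seq ext f (nat_of_ord x) | x <- s]).
have -> : #|[pred f : Omega | ~~ avoiding m (F m) k (ext f)]| =
    \sum_(f : Omega) (~~ avoiding m (F m) k (ext f) : nat).
  by rewrite -sum1_card [LHS]big_mkcond.
apply: (@leq_trans (2 ^ m *
   \sum_(f : Omega) \sum_(l < k) \sum_(i < k) \sum_(s : k.-tuple 'I_k) clash l i s f)).
  rewrite leq_pmul2l ?expn_gt0 //; apply: leq_sum => f _.
  case: (boolP (avoiding _ _ _ _)) => //= /forallPn[l] /forallPn[i] /forallPn[s].
  rewrite negb_imply negbK => cl.
  by rewrite (bigD1 l) //= (bigD1 i) //= (bigD1 s) //= /clash cl.
rewrite exchange_big big_distrr /=.
apply: (@leq_trans (\sum_(l < k) k * k ^ k * #|Omega|)); last first.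
  by rewrite sum_nat_const card_ord mulnA.
apply: leq_sum => l _; rewrite exchange_big big_distrr /=.
apply: (@leq_trans (\sum_(i < k) k ^ k * #|Omega|)); last first.
  by rewrite sum_nat_const card_ord mulnA.
apply: leq_sum => i _; rewrite exchange_big big_distrr /=.
apply: (@leq_trans (\sum_(s : k.-tuple 'I_k) #|Omega|)); last first.
  by rewrite sum_nat_const card_tuple card_ord.
apply: leq_sum => s _.
have [si|si] := boolP (i \in s).
  by rewrite big1 ?muln0 // => f _; rewrite /clash si.
have iJ : i < J.+1 by apply: leq_trans kJ.
pose G (f : Omega) := F m l [seq ext f (nat_of_ord x) | x <- s].
have Gi (f : Omega) b : G (fupd f (inord i) b) = G f.
  rewrite /G; congr (F m l _); apply/eq_in_map => x xs.
  rewrite ext_fupd ?inE ?(leq_trans (ltn_ord x)) // /upd.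
  by case: eqP => // /val_inj xi; rewrite -xi xs in si.
apply: leq_trans (card_congruent (precise kJ) Gi).
suff -> : \sum_f clash l i s f = #|[pred f : Omega | f (inord i) %% 2 ^ m == G f]|.
  by [].
rewrite -sum1_card [RHS]big_mkcond; apply: eq_bigr => f _.
by rewrite /clash si.
Qed.

(** The proportion bound does not involve [n], [J] or [F], which is why
[precision] can be a fixed function of the level. *)
Lemma card_good k : k <= J.+1 ->
  #|Omega| <= sparsity k * #|[pred f : Omega | good precision F k (ext f)]|.
Proof.
elim: k => [_|k IH kJ]; first by rewrite mul1n.
set D := #|[pred f | good _ _ k.+1 _]|.
pose E := [pred f | good precision F k (ext f) &&
   good precision F k (ext (fupd f (inord (parent k)) (f (inord k))))].
have O0 : 0 < #|Omega| by rewrite card_ffun !card_ord expn_gt0 expn_gt0.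
have hE : #|Omega| <= sparsity k ^ 2 * #|E|.
  rewrite -(leq_pmul2l O0).
  have [k0|k0] := posnP k.
    have -> : #|E| = #|Omega| by apply: eq_card => f; rewrite inE /= k0.
    by rewrite k0 mul1n.
  have pk : inord (parent k) != inord k :> 'I_J.+1.
    have pk := parent_lt k0; rewrite -(inj_eq val_inj) /= !inordK; lia.
  have Dk (f : Omega) b :
      good precision F k (ext (fupd f (inord k) b)) = good precision F k (ext f).
    apply: eq_good => x xk; rewrite ext_fupd ?inE //; last by lia.
    by rewrite /upd; case: eqP => // xk'; lia.
  have := card_clone (D := [pred f | good precision F k (ext f)]) pk Dk.
  rewrite -/E => clone.
  have := IH (ltnW kJ); rewrite -leq_sqr expnMn expnS expn1 => /leq_trans; apply.
  by rewrite [X in _ <= X]mulnCA leq_mul2l clone orbT.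
have hB := card_not_avoiding kJ.
set Bad := #|_| in hB.
have sub : #|E| <= D + Bad.
  rewrite /D /Bad -cardUI; apply: leq_trans (leq_addr _ _).
  apply: subset_leq_card; apply/fintype.subsetP => f; rewrite !inE => /andP[g1 g2].
  rewrite [good _ _ _ _]/= g1.
  suff -> : good precision F k (upd (ext f) (parent k) (ext f k)) by exact: orbN.
  rewrite -(@eq_good precision F k (ext (fupd f (inord (parent k)) (f (inord k)))))
    // => x xk.
  by rewrite ext_fupd ?inE //; have := parent_le k; lia.
set t := _ * (_ * _) in hB.
have t0 : 0 < t by rewrite !muln_gt0 expn_gt0.
have {}hB : sparsity k.+1 * Bad <= #|Omega|.
  rewrite -(leq_pmul2l t0); apply: leq_trans hB; rewrite mulnA leq_mul2r mulnC.
  by rewrite [X in _ || X]ltnW ?orbT // ltn_expl.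
move: hB hE sub => /=; move: (sparsity k ^ 2) => S; move: #|Omega| D Bad #|E|.
move=> o d b e; nia.
Qed.

End Density.

Lemma exists_good (J : nat) (F : nat -> nat -> seq nat -> nat) :
  exists c, good precision F J c.
Proof.
pose n := \max_(k < J.+2) precision k.
have nP k : k <= J.+1 -> precision k <= n.
  move=> kJ; exact: (leq_bigmax (Ordinal (kJ : k < J.+2))).
have := card_good F nP (leqnSn J).
have O0 : 0 < #|{ffun 'I_J.+1 -> 'I_(2 ^ n)}|.
  by rewrite card_ffun !card_ord expn_gt0 expn_gt0.
move=> /(leq_trans O0); rewrite muln_gt0 => /andP[_ /card_gt0P[f fP]].
by exists (fun x => nat_of_ord (f (inord x))).
Qed.

(** * Splitting the reals into buckets *)

(** The number whose binary digits are the first [d] values of [x]. *)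
Fixpoint bits_sum (x : nat -> bool) (d : nat) : nat :=
  if d is d'.+1 then bits_sum x d' + x d' * 2 ^ d' else 0.

Lemma bits_sum_lt x d : bits_sum x d < 2 ^ d.
Proof. by elim: d => //= d IH; rewrite expnS; case: (x d) => /=; lia. Qed.

Lemma bits_sum_inj x y d : bits_sum x d = bits_sum y d ->
  forall i, i < d -> x i = y i.
Proof.
elim: d => //= d IH e i.
have lx := bits_sum_lt x d; have ly := bits_sum_lt y d.
have xyd : x d = y d by move: e; case: (x d) (y d) => [] [] //=; lia.
rewrite ltnS leq_eqVlt => /orP[/eqP -> //|]; apply: IH.
by move: e; rewrite xyd; lia.
Qed.

Lemma bits_sum_mod n d : bits_sum (fun i => odd (n %/ 2 ^ i)) d = n %% 2 ^ d.
Proof.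
elim: d => [|d IH] /=; first by rewrite modn1.
rewrite IH; set q := n %/ 2 ^ d; set r := n %% 2 ^ d.
have r_lt : r < 2 ^ d by rewrite ltn_pmod ?expn_gt0.
have -> : n = q./2 * 2 ^ d.+1 + (r + odd q * 2 ^ d).
  rewrite {1}(divn_eq n (2 ^ d)) -/q -/r -{1}(odd_double_half q) expnS.
  by rewrite -muln2; lia.
by rewrite modnMDl modn_small // expnS; case: (odd q); lia.
Qed.

Lemma eq_bits_sum x y d : (forall i, i < d -> x i = y i) ->
  bits_sum x d = bits_sum y d.
Proof.
elim: d => //= d IH e; rewrite e // IH // => i id; apply: e; lia.
Qed.

Lemma odd_bits_sum x d e i : i < d -> odd ((2 ^ d * e + bits_sum x d) %/ 2 ^ i) = x i.
Proof.
move=> id; set n := _ + _.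
have nx : bits_sum (fun i => odd (n %/ 2 ^ i)) d = bits_sum x d.
  by rewrite bits_sum_mod /n mulnC modnMDl modn_small ?bits_sum_lt.
exact: bits_sum_inj nx i id.
Qed.

(** Linear hashing into [k] buckets, where [2 ^ d <= k < 2 ^ d.+1]: the reals
are sorted by their first [d.+1] digits if that bucket exists already, and by
their first [d] digits otherwise. *)
Definition bucket (k : nat) (x : nat -> bool) : nat :=
  let d := trunc_log 2 k in
  if bits_sum x d.+1 < k then bits_sum x d.+1 else bits_sum x d.

Lemma bucket_lt k x : 0 < k -> bucket k x < k.
Proof.
move=> k0; rewrite /bucket; case: ifP => // _.
exact: leq_trans (bits_sum_lt _ _) (trunc_logP _ k0).
Qed.

Lemma bucket_succ k x : 0 < k ->
  bucket k.+1 x = bucket k x \/ bucket k.+1 x = k /\ bucket k x = parent k.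
Proof.
move=> k0; rewrite /parent.
have /andP[dk kd] := trunc_log_bounds (isT : 1 < 2) k0.
rewrite /bucket; set d := trunc_log 2 k in dk kd *.
have l1 := bits_sum_lt x d; have l2 := bits_sum_lt x d.+1.
have [kd1|kd1] := ltnP k.+1 (2 ^ d.+1).
  have -> : trunc_log 2 k.+1 = d by apply: trunc_log_eq; rewrite // kd1 ltnW.
  move: l1 l2; rewrite expnS /=; case: (x d) => /= ? ?; do 2 (case: ltnP => ?); lia.
have kd2 : k.+1 = 2 ^ d.+1 by lia.
rewrite kd2 trunc_expnK // -kd2.
have -> : bits_sum x d.+2 = bits_sum x d.+1 + x d.+1 * 2 ^ d.+1 by [].
have l4 : bits_sum x d.+1 = bits_sum x d + x d * 2 ^ d by [].
move: kd2 l1 l2 l4; rewrite expnS.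
move: (bits_sum x d.+1) (bits_sum x d) (2 ^ d) => s s' t.
by case: (x d); case: (x d.+1) => /= ? ? ? ?; do 2 (case: ltnP => ?); lia.
Qed.

Lemma bucket_pow d x : bucket (2 ^ d) x = bits_sum x d.
Proof.
rewrite /bucket trunc_expnK //=; have := bits_sum_lt x d.
by case: (x d) => /= ?; case: ltnP; lia.
Qed.

Lemma bucket_onto k i : i < k -> exists x, bucket k x = i.
Proof.
move=> ik; exists (fun j => odd (i %/ 2 ^ j)); rewrite /bucket.
have := trunc_log_ltn k (isT : 1 < 2) => kd.
by rewrite bits_sum_mod modn_small ?ik // (leq_trans ik) // ltnW.
Qed.

Lemma bucket_sep x y k k' : 0 < k -> k <= k' -> bucket k x != bucket k y ->
  bucket k' x != bucket k' y.
Proof.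
move=> k0 /subnK <-; elim: (k' - k) => // n IH /IH.
rewrite addSn; set K := n + k; have K0 : 0 < K by rewrite /K; lia.
have := bucket_lt x K0; have := bucket_lt y K0.
move=> ? ? ?; apply/eqP.
by case: (bucket_succ x K0) (bucket_succ y K0) => [?|[??]] [?|[??]]; lia.
Qed.

Lemma bucket_eventually_sep x y : (exists i, x i != y i) ->
  exists k, forall k', k <= k' -> bucket k' x != bucket k' y.
Proof.
move=> [i xi]; exists (2 ^ i.+1) => k' kk'.
apply: bucket_sep kk' _; rewrite ?expn_gt0 //.
by rewrite !bucket_pow; apply: contra xi => /eqP/bits_sum_inj ->.
Qed.

(** A configuration that is good at the level [J] yields one at every lower
level [k], by letting any real [e i] of the bucket [i] at the level [k] stand
for that bucket.  This is proved downwards in [k]: of the reals chosen at the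
level [K], at most the one in the bucket [parent K] moves, namely to the new
bucket [K], and the duplication clause of [good] covers that case. *)
Lemma good_buckets m F J c : good m F J c ->
  forall k, 0 < k <= J -> forall e : nat -> nat -> bool,
    (forall i, i < k -> bucket k (e i) = i) ->
    good m F k (fun i => c (bucket J (e i))).
Proof.
move=> gJ k /andP[k0 kJ]; rewrite -(subKn kJ); move: (leq_subr k J).
have : J - k < J by lia.
elim: (J - k) => [|n IH] nJ nJ' e he.
  rewrite subn0; rewrite -(@eq_good _ _ _ c) // => x xJ.
  by rewrite -{1}(he x) subn0.
set K := J - n.+1; have K0 : 0 < K by rewrite /K; lia.
have KS : J - n = K.+1 by rewrite /K; lia.
have {IH}IH e' : (forall i, i < K.+1 -> bucket K.+1 (e' i) = i) ->
    good m F K.+1 (fun i => c (bucket J (e' i))).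
  by move=> he'; rewrite -KS; apply: IH; rewrite ?KS //; lia.
have pK := parent_lt K0.
have heS i : i < K -> bucket K.+1 (e i) = i \/
    bucket K.+1 (e i) = K /\ i = parent K.
  by move=> iK; have := bucket_succ (e i) K0; rewrite he.
(* If [e (parent K)] moves to the new bucket, some [z] must replace it. *)
have [eK|eK] := eqVneq (bucket K.+1 (e (parent K))) K.
  have [z hz] : exists z, bucket K.+1 z = parent K by apply: bucket_onto; lia.
  pose e' i := if i == K then e (parent K) else if i == parent K then z else e i.
  have /IH/and3P[_ + _] : forall i, i < K.+1 -> bucket K.+1 (e' i) = i.
    move=> i iK; rewrite /e'; case: eqP => [-> //|iK']; case: eqP => [-> //|ip].
    by case: (heS i) => [|//|[_ //]]; lia.
  apply: eq_ind; apply: eq_good => x xK.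
  rewrite /upd /e' eqxx; case: eqP => [-> //|_].
  by rewrite ltn_eqF.
have [z hz] : exists z, bucket K.+1 z = K by apply: bucket_onto.
pose e' i := if i == K then z else e i.
have /IH/and3P[+ _ _] : forall i, i < K.+1 -> bucket K.+1 (e' i) = i.
  move=> i iK; rewrite /e'; case: eqP => [-> //|iK'].
  have iK2 : i < K by lia.
  case: (heS i iK2) => // -[h1 h2]; move: eK; rewrite -h2 h1 eqxx //.
apply: eq_ind; apply: eq_good => x xK.
by rewrite /e' ltn_eqF.
Qed.

Lemma bucket_separates n (y : nat -> nat -> bool) :
  exists k0, forall k, k0 <= k -> forall p q, p < n -> q < n ->
    bucket k (y p) = bucket k (y q) -> y p = y q.
Proof.
have /choice[K KP] (u : 'I_n * 'I_n) : exists k0, forall k, k0 <= k ->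
    bucket k (y u.1) = bucket k (y u.2) -> y u.1 = y u.2.
  have [->|yne] := EM (y u.1 = y u.2); first by exists 0.
  have [k0 kP] : exists k0, forall k, k0 <= k ->
      bucket k (y u.1) != bucket k (y u.2).
    apply: bucket_eventually_sep; apply: contrapT => alleq; apply: yne.
    apply/funext => i; apply/eqP; apply: contrapT => /negP ne.
    by apply: alleq; exists i.
  by exists k0 => k /kP /eqP.
exists (\max_u K u) => k kk p q pn qn.
by apply: (KP (Ordinal pn, Ordinal qn)); apply: leq_trans kk; exact: leq_bigmax.
Qed.

(** The finite problem solved at stage [J], with arbitrary functions [F]. *)
Lemma generic_values (J : nat) (F : nat -> nat -> seq nat -> nat) :
  exists C : nat -> nat, forall k l x (y : nat -> nat -> bool),
    l < k -> k <= J ->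
    (forall q, q < k -> bucket k x <> bucket k (y q)) ->
    (forall p q, p < k -> q < k -> bucket k (y p) = bucket k (y q) -> y p = y q) ->
    C (bucket J x) %% 2 ^ precision k
      <> F (precision k) l (mkseq (fun q => C (bucket J (y q))) k).
Proof.
have [C gC] := exists_good J F; exists C => k l x y lk kJ xy yy.
have k0 : 0 < k by lia.
have /choice[e eP] (i : nat) : exists z, i < k -> [/\ bucket k z = i,
    bucket k x = i -> z = x & forall q, q < k -> bucket k (y q) = i -> z = y q].
  have [ik|ik] := ltnP i k; last by exists x; lia.
  have [xi|xi] := EM (bucket k x = i).
    by exists x => _; split => // q qk yq; case: (xy q qk); rewrite xi yq.
  have [[q qk qi]|nq] := EM (exists2 q, q < k & bucket k (y q) = i).
    by exists (y q) => _; split => // p pk pi; apply: yy => //; rewrite pi qi.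
  have [z zi] := bucket_onto ik.
  by exists z => _; split => // q qk qi; case: nq; exists q.
have ebucket i : i < k -> bucket k (e i) = i by move=> /eP[].
have gk : good precision F k (fun i => C (bucket J (e i))).
  by apply: good_buckets gC _ _ _ ebucket; rewrite k0.
have {gk} : avoiding (precision k) (F (precision k)) k (fun i => C (bucket J (e i))).
  by case: (k) k0 gk => // k' _ /and3P[].
have yk q : q < k -> bucket k (y q) < k by move=> _; exact: bucket_lt.
pose s := [tuple Ordinal (bucket_lt (y i) k0) | i < k].
move=> /forallP/(_ (Ordinal lk))/forallP/(_ (Ordinal (bucket_lt x k0))).
move=> /forallP/(_ s)/implyP; have -> : Ordinal (bucket_lt x k0) \notin s.
  by apply/mapP => -[i _ /(congr1 val)/=]; exact: xy.
have -> : [seq C (bucket J (e (nat_of_ord i))) | i <- s] =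
    mkseq (fun q => C (bucket J (y q))) k.
  rewrite /= -map_comp /mkseq -val_enum_ord -map_comp; apply: eq_map => i /=.
  have [_ _ /(_ i (ltn_ord i) erefl) -> //] := eP _ (bucket_lt (y i) k0).
have [_ /(_ erefl) /= -> _] := eP _ (bucket_lt x k0).
by move=> /(_ isT)/eqP.
Qed.

(** * Numerals and their digits *)

Section Numerals.
Variables (T : Type) (M : structure T).
Hypothesis PA : models_PA M.
Notation num := (numeral M).

Lemma numeral_dom n : dom M (num n).
Proof. by elim: n => [|n IH]; [exact: dom_zero|exact: dom_succ]. Qed.

Lemma numeral_inj : injective num.
Proof.
elim=> [|m IH] [|n] //=.
- by move/esym/(PA_succ_neq0 PA (numeral_dom n)).
- by move/(PA_succ_neq0 PA (numeral_dom m)).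
- by move/(PA_succ_inj PA (numeral_dom m) (numeral_dom n))/IH->.
Qed.

Lemma numeralD m n : num (m + n) = add M (num m) (num n).
Proof.
elim: n => [|n IH]; first by rewrite addn0 /= (PA_add0 PA) //; exact: numeral_dom.
by rewrite addnS /= (PA_addS PA) ?IH //; exact: numeral_dom.
Qed.

Lemma numeralM m n : num (m * n) = mul M (num m) (num n).
Proof.
elim: n => [|n IH]; first by rewrite muln0 /= (PA_mul0 PA) //; exact: numeral_dom.
by rewrite mulnS addnC numeralD /= (PA_mulS PA) ?IH //; exact: numeral_dom.
Qed.

Lemma zero_or_succ x : dom M x ->
  x = zero M \/ exists2 y, dom M y & x = succ M y.
Proof.
pose phi := Imp (Imp (Eq (Var 0) Zero) Bot)
  (Imp (All (Imp (Eq (Var 1) (Succ (Var 0))) Bot)) Bot).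
have phiP y v : sat M (scons y v) phi <->
    (y = zero M \/ exists2 z, dom M z & y = succ M z).
  split=> [h|[->|[z Dz ->]] /=].
  - have [|y0] := EM (y = zero M); [by left|right; apply: contrapT => nz].
    by apply: h => //= z Dz yz; apply: nz; exists z.
  - by move=> /(_ erefl).
  - by move=> _ /(_ z Dz)/(_ erefl).
have D0 : assignment M (fun=> zero M) by move=> n; exact: dom_zero.
move=> Dx; apply/(phiP _ (fun=> zero M)); apply: (PA_ind PA D0) => //.
- by apply/phiP; left.
- by move=> y Dy _; apply/phiP; right; exists y.
Qed.

(** Numerals form an initial segment; hence the witnesses of a digit of a
numeral are numerals. *)
Lemma add_numeral x y n : dom M x -> dom M y -> add M x y = num n ->
  exists a b, [/\ x = num a, y = num b & a + b = n].
Proof.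
move=> Dx Dy; elim: n y Dy => [|n IH] y Dy; case: (zero_or_succ Dy) => [->|[z Dz ->]].
- by rewrite (PA_add0 PA) // => ->; exists 0, 0.
- by rewrite (PA_addS PA) // => /(PA_succ_neq0 PA) []; exact: dom_add.
- by rewrite (PA_add0 PA) // => ->; exists n.+1, 0; rewrite addn0.
- rewrite (PA_addS PA) //= => /(PA_succ_inj PA (dom_add Dx Dz) (numeral_dom n)).
  by move=> /(IH _ Dz)[a [b [-> -> <-]]]; exists a, b.+1; rewrite addnS.
Qed.

Lemma bit1_numeral n i : bit1 M (num n) i <-> odd (n %/ 2 ^ i).
Proof.
have e0 : 0 < 2 ^ i by rewrite expn_gt0.
split=> [[q [r [Dq Dr [z [Dz rz]] nE]]]|odd_n].
  have [a [b [rE /= zE ab]]] := add_numeral Dr (dom_succ Dz) rz.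
  have Dqq := dom_succ (dom_add Dq Dq).
  have := esym nE; rewrite -(prednK e0) /= (PA_mulS PA) //; last exact: numeral_dom.
  have Dm := dom_mul Dqq (numeral_dom (2 ^ i).-1).
  move=> /(add_numeral (dom_add Dm Dqq) Dr)[u [v [uE _ _]]].
  have [_ [w [_ wE _]]] := add_numeral Dm Dqq uE.
  have Dn := numeral_dom.
  case: w wE => [|w] /=; first by move/(PA_succ_neq0 PA (dom_add Dq Dq)).
  move/(PA_succ_inj PA (dom_add Dq Dq) (Dn _)).
  move/(add_numeral Dq Dq)=> [c [_ [cE _ _]]].
  move: nE; rewrite cE rE -numeralD -[succ M _]/(num (c + c).+1).
  rewrite -numeralM -numeralD => /numeral_inj ->.
  have ai : a < 2 ^ i.
    case: (b) zE ab => [/(PA_succ_neq0 PA Dz) //|b' _ <-]; lia.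
  by rewrite (prednK e0) divnMDl // (divn_small ai) addn0 addnn /= odd_double.
exists (num (n %/ 2 ^ i)./2), (num (n %% 2 ^ i)); split; try exact: numeral_dom.
  exists (num (2 ^ i - (n %% 2 ^ i).+1)); split; first exact: numeral_dom.
  rewrite -[succ M _]/(num (2 ^ i - (n %% 2 ^ i).+1).+1) -numeralD; congr num.
  have := ltn_pmod n e0; lia.
rewrite -numeralD -[succ M _]/(num _.+1) -numeralM -numeralD; congr num.
by rewrite [LHS](divn_eq n (2 ^ i)) -{1}(odd_double_half (n %/ 2 ^ i)) odd_n addnn.
Qed.

Lemma coded_set_numeral n d (x : nat -> bool) i : i < d ->
  bit1 M (num (2 ^ d * n + bits_sum x d)) i <-> x i.
Proof. by move=> id; rewrite bit1_numeral odd_bits_sum. Qed.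

End Numerals.

(** * Skolem functions and the theorem of Los *)

Fixpoint term_bound (t : term) : nat :=
  match t with
  | Var n => n.+1
  | Zero => 0
  | Succ t => term_bound t
  | Add t u | Mul t u => maxn (term_bound t) (term_bound u)
  end.

Fixpoint formula_bound (phi : formula) : nat :=
  match phi with
  | Eq t u => maxn (term_bound t) (term_bound u)
  | Bot => 0
  | Imp phi psi => maxn (formula_bound phi) (formula_bound psi)
  | All phi => formula_bound phi
  end.

Lemma eq_eval U (N : structure U) v w t :
  (forall n, n < term_bound t -> v n = w n) -> eval N v t = eval N w t.
Proof.
elim: t => //= [n|t IH|t IHt u IHu|t IHt u IHu] vw; first exact: vw.
- by rewrite IH.
- by rewrite IHt ?IHu // => n nb; apply: vw; lia.
- by rewrite IHt ?IHu // => n nb; apply: vw; lia.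
Qed.

Lemma eq_sat U (N : structure U) phi v w :
  (forall n, n < formula_bound phi -> v n = w n) -> sat N v phi <-> sat N w phi.
Proof.
elim: phi v w => //= [t u|phi IHphi psi IHpsi|phi IH] v w vw.
- by rewrite !(@eq_eval _ _ v w) // => n nb; apply: vw; lia.
- have [h1 h2] : (sat N v phi <-> sat N w phi) /\ (sat N v psi <-> sat N w psi).
    by split; [apply: IHphi|apply: IHpsi] => n nb; apply: vw; lia.
  by rewrite h1 h2.
- suff h a : sat N (scons a v) phi <-> sat N (scons a w) phi.
    by split=> s a /s /h.
  by apply: IH => -[|n] //= nb; apply: vw; lia.
Qed.

Definition And phi psi := Imp (Imp phi (Imp psi Bot)) Bot.
Definition Ex phi := Imp (All (Imp phi Bot)) Bot.

Lemma sat_And U (N : structure U) v phi psi :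
  sat N v (And phi psi) <-> sat N v phi /\ sat N v psi.
Proof.
split=> [h|[h1 h2] /= h]; last exact: h.
by apply: contrapT => h'; apply: h => h1 h2; apply: h'.
Qed.

Lemma sat_Ex U (N : structure U) v phi :
  sat N v (Ex phi) <-> exists2 a, dom N a & sat N (scons a v) phi.
Proof.
split=> [h|[a Da ha] /= h]; last exact: (h a).
by apply: contrapT => h'; apply: h => a Da ha; apply: h'; exists a.
Qed.

Definition numeral_term n := iter n Succ Zero.

Lemma eval_numeral_term U (N : structure U) v n :
  eval N v (numeral_term n) = numeral N n.
Proof. by elim: n => //= n ->. Qed.

(** The definition of [bit1] as a formula about the variable 0; under the two
outer quantifiers [q] is variable 1, [r] is variable 0 and the number itself is
variable 2. *)
Definition bit_formula i :=
  Ex (Ex (And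
    (Ex (Eq (Add (Var 1) (Succ (Var 0))) (numeral_term (2 ^ i))))
    (Eq (Var 2) (Add (Mul (Succ (Add (Var 1) (Var 1))) (numeral_term (2 ^ i)))
                     (Var 0))))).

Lemma sat_bit_formula U (N : structure U) b v i :
  sat N (scons b v) (bit_formula i) <-> bit1 N b i.
Proof.
split.
  move=> /sat_Ex[q Dq] /sat_Ex[r Dr] /sat_And[/sat_Ex[z Dz] /=].
  rewrite !eval_numeral_term => rz bE.
  by exists q, r; split => //; exists z.
move=> [q [r [Dq Dr [z [Dz rz]] bE]]].
apply/sat_Ex; exists q => //; apply/sat_Ex; exists r => //; apply/sat_And; split.
  by apply/sat_Ex; exists z => //=; rewrite eval_numeral_term.
by rewrite /= eval_numeral_term.
Qed.

(** A choice that depends only on the set [P], so that it picks one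
representative from each equivalence class. *)
Definition member U (d : U) (P : set U) : U :=
  if pselect (exists x, P x) is left ex then projT1 (cid ex) else d.

Lemma memberP U (d : U) (P : set U) : (exists x, P x) -> P (member d P).
Proof. by rewrite /member; case: pselect => // ex _; case: cid. Qed.

Section Ultrapower.
Variables (T : Type) (M : structure T) (W : set_system nat).
Context {W_ultra : UltraFilter W}.
Implicit Types (f g : nat -> T) (G H : set (nat -> T)) (v : nat -> nat -> T).

Lemma ultra_not (A : set nat) : W (~` A) <-> ~ W A.
Proof.
split=> [WnA WA|nWA]; last by case: (in_ultra_setVsetC A W_ultra).
by apply: (@filter_not_empty _ W); rewrite -(setICl A); exact: filterI.
Qed.

Lemma ultra_iff (P Q : nat -> Prop) : (W P <-> W Q) -> W [set j | P j <-> Q j].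
Proof.
move=> PQ; have [WP|/ultra_not WP] := EM (W P).
  by apply: filterS (filterI WP (PQ.1 WP)) => j [].
have /ultra_not WQ : ~ W Q by move=> /PQ.2; exact/ultra_not.
by apply: filterS (filterI WP WQ) => j [].
Qed.

Definition ae_eq f g := W [set j | f j = g j].

Lemma ae_eq_sym f g : ae_eq f g -> ae_eq g f.
Proof. by apply: filterS => j /= ->. Qed.

Lemma ae_eq_trans f g h : ae_eq f g -> ae_eq g h -> ae_eq f h.
Proof. by move=> fg gh; apply: filterS (filterI fg gh) => j /= [-> ->]. Qed.

(** The ultrapower is built on representatives of the classes of sequences,
so that inclusion of hulls is inclusion of domains in a single type. *)
Definition repr f : nat -> T := member (fun=> zero M) [set g | ae_eq f g].

Lemma repr_ae f : ae_eq f (repr f).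
Proof.
apply: (memberP (fun=> zero M) (P := [set g | ae_eq f g])).
by exists f; apply: filterS filterT.
Qed.

Lemma repr_eq f g : repr f = repr g <-> ae_eq f g.
Proof.
split=> [e|fg].
  by apply: ae_eq_trans (repr_ae f) _; rewrite e; exact/ae_eq_sym/repr_ae.
rewrite /repr; congr member; apply/seteqP; split=> h /=; apply: ae_eq_trans => //.
exact: ae_eq_sym.
Qed.

(** A counterexample to [All phi], if there is one.  A finite list of values is
enough since [phi] has finitely many variables. *)
Definition skolem (phi : formula) (s : seq T) : T :=
  member (zero M) [set a | dom M a /\ ~ sat M (scons a (nth (zero M) s)) phi].

Lemma skolem_dom phi s : dom M (skolem phi s).
Proof.
rewrite /skolem /member; case: pselect => [ex|_]; last exact: dom_zero.
by case: cid => a [].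
Qed.

Lemma skolemP phi s a : dom M a -> ~ sat M (scons a (nth (zero M) s)) phi ->
  ~ sat M (scons (skolem phi s) (nth (zero M) s)) phi.
Proof.
move=> Da nsat; have [] // := memberP (zero M)
  (P := [set a | dom M a /\ ~ sat M (scons a (nth (zero M) s)) phi]).
by exists a.
Qed.

(** Skolem functions of equations compute terms, so that closure under Skolem
functions includes closure under the operations. *)
Lemma skolem_value t s b : dom M b ->
  (forall a, eval M (scons a (nth (zero M) s)) t = b) ->
  skolem (Imp (Eq (Var 0) t) Bot) s = b.
Proof.
move=> Db tb; have /= := @skolemP (Imp (Eq (Var 0) t) Bot) s b Db.
rewrite !tb => h; by apply: contrapT => ne; apply: h.
Qed.

Record skolem_closed G : Prop := SkolemClosed {
  closed_dom : forall f, G f -> forall j, dom M (f j);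
  closed_cst : forall a, dom M a -> G (fun=> a);
  closed_skolem : forall phi k v, (forall n, G (v n)) ->
    G (fun j => skolem phi (mkseq (v^~ j) k)) }.

Lemma closed_value G t k v g : skolem_closed G ->
  (forall n, G (v n)) -> (forall j, dom M (g j)) ->
  (forall j a, eval M (scons a (nth (zero M) (mkseq (v^~ j) k))) t = g j) ->
  G g.
Proof.
move=> GC Gv Dg tg; have := closed_skolem GC (Imp (Eq (Var 0) t) Bot) k Gv.
by congr G; apply/funext => j; apply: skolem_value.
Qed.

Lemma closed_succ G f : skolem_closed G -> G f -> G (fun j => succ M (f j)).
Proof.
move=> GC Gf; apply: (@closed_value _ (Succ (Var 1)) 1 (fun=> f)) => // j.
exact/dom_succ/(closed_dom GC).
Qed.

Lemma closed_add G f g : skolem_closed G -> G f -> G g ->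
  G (fun j => add M (f j) (g j)).
Proof.
move=> GC Gf Gg; apply: (@closed_value _ (Add (Var 1) (Var 2)) 2
    (fun n => if n == 0 then f else g)) => //.
- by case.
- by move=> j; apply: dom_add; exact: (closed_dom GC).
Qed.

Lemma closed_mul G f g : skolem_closed G -> G f -> G g ->
  G (fun j => mul M (f j) (g j)).
Proof.
move=> GC Gf Gg; apply: (@closed_value _ (Mul (Var 1) (Var 2)) 2
    (fun n => if n == 0 then f else g)) => //.
- by case.
- by move=> j; apply: dom_mul; exact: (closed_dom GC).
Qed.

Lemma repr_succ f : repr (fun j => succ M (repr f j)) = repr (fun j => succ M (f j)).
Proof. by apply/esym/repr_eq; apply: filterS (repr_ae f) => j /= <-. Qed.

Lemma repr_add f g :
  repr (fun j => add M (repr f j) (repr g j)) = repr (fun j => add M (f j) (g j)).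
Proof.
apply/esym/repr_eq; apply: filterS (filterI (repr_ae f) (repr_ae g)) => j /=.
by case=> <- <-.
Qed.

Lemma repr_mul f g :
  repr (fun j => mul M (repr f j) (repr g j)) = repr (fun j => mul M (f j) (g j)).
Proof.
apply/esym/repr_eq; apply: filterS (filterI (repr_ae f) (repr_ae g)) => j /=.
by case=> <- <-.
Qed.

Section Structure.
Variables (G : set (nat -> T)) (GC : skolem_closed G).

Lemma reduced_zero : (repr @` G) (repr (fun=> zero M)).
Proof. by exists (fun=> zero M) => //; apply: closed_cst (dom_zero M). Qed.

Lemma reduced_succ x : (repr @` G) x -> (repr @` G) (repr (fun j => succ M (x j))).
Proof.
case=> f Gf <-; exists (fun j => succ M (f j)); first exact: closed_succ.
by rewrite repr_succ.
Qed.

Lemma reduced_add x y : (repr @` G) x -> (repr @` G) y ->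
  (repr @` G) (repr (fun j => add M (x j) (y j))).
Proof.
case=> f Gf <- [g Gg <-].
exists (fun j => add M (f j) (g j)); first exact: closed_add.
by rewrite repr_add.
Qed.

Lemma reduced_mul x y : (repr @` G) x -> (repr @` G) y ->
  (repr @` G) (repr (fun j => mul M (x j) (y j))).
Proof.
case=> f Gf <- [g Gg <-].
exists (fun j => mul M (f j) (g j)); first exact: closed_mul.
by rewrite repr_mul.
Qed.

Definition reduced_power : structure (nat -> T) :=
  Structure reduced_zero reduced_succ reduced_add reduced_mul.

Lemma eval_reduced_power v t :
  eval reduced_power (fun n => repr (v n)) t = repr (fun j => eval M (v^~ j) t).
Proof.
by elim: t => //= [t ->|t -> u ->|t -> u ->];
  rewrite (repr_succ, repr_add, repr_mul).
Qed.

Lemma repr_scons f v : scons (repr f) (fun n => repr (v n)) =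
  (fun n => repr (scons f v n)).
Proof. by apply/funext; case. Qed.

Lemma scons_at f v j : (fun n => scons f v n j) = scons (f j) (v^~ j).
Proof. by apply/funext; case. Qed.

(** The theorem of Los for a Skolem-closed family of sequences instead of the
full power: if [All phi] fails at almost every stage, then the sequence of the
counterexamples that the Skolem function of [phi] supplies is in the family. *)
Lemma Los phi v : (forall n, G (v n)) ->
  sat reduced_power (fun n => repr (v n)) phi <-> W [set j | sat M (v^~ j) phi].
Proof.
elim: phi v => [t u||phi IHphi psi IHpsi|phi IH] v Gv /=.
- by rewrite !eval_reduced_power repr_eq.
- split=> // /(@filter_not_empty _ W) //.
- rewrite (IHphi _ Gv) (IHpsi _ Gv); split=> [h|WI Wphi].
    have [/h|/ultra_not] := EM (W [set j | sat M (v^~ j) phi]).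
      by apply: filterS => j psij _.
    by apply: filterS => j nphi /nphi.
  by apply: filterS (filterI WI Wphi) => j /= [h /h].
split=> [h|Wall _ [f Gf <-]]; last first.
  have Gs n : G (scons f v n) by case: n.
  rewrite repr_scons (IH _ Gs); apply: filterS Wall => j /= /(_ (f j)) s.
  by rewrite scons_at; apply/s/(closed_dom GC).
pose s j := mkseq (v^~ j) (formula_bound phi).
pose f j := skolem phi (s j).
have Gf : G f by apply: closed_skolem.
have Gs n : G (scons f v n) by case: n.
have := h (repr f) (imageP _ Gf); rewrite repr_scons (IH _ Gs).
have sE a j : sat M (scons a (nth (zero M) (s j))) phi <->
              sat M (scons a (v^~ j)) phi.
  by apply: eq_sat => -[|n] //= nb; rewrite nth_mkseq //; lia.
apply: filterS => j /=; rewrite scons_at -sE => sf a Da.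
by rewrite -sE; apply: contrapT => /(skolemP Da).
Qed.

Lemma numeral_reduced_power n : numeral reduced_power n = repr (fun=> numeral M n).
Proof. by elim: n => //= n ->; rewrite repr_succ. Qed.

Lemma bit1_reduced_power f i : G f ->
  bit1 reduced_power (repr f) i <-> W [set j | bit1 M (f j) i].
Proof.
move=> Gf; have G0 : G (fun=> zero M) by apply: closed_cst (dom_zero M).
rewrite -(sat_bit_formula _ _ (fun=> repr (fun=> zero M))) repr_scons.
rewrite Los; last by case.
have bitE j : sat M ((scons f (fun _ _ => zero M))^~ j) (bit_formula i) <->
    bit1 M (f j) i by rewrite scons_at sat_bit_formula.
by split; apply: filterS => j /bitE.
Qed.

Lemma reduced_power_assignment (w : nat -> nat -> T) : assignment reduced_power w ->
  exists2 v, (forall n, G (v n)) & w = (fun n => repr (v n)).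
Proof.
move=> Dw; have /choice[v vP] n : exists f, G f /\ repr f = w n.
  by have [f] := Dw n; exists f.
by exists v => [n|]; [case: (vP n)|apply/funext => n; case: (vP n)].
Qed.

End Structure.

Lemma elementary_reduced_power G H (GC : skolem_closed G) (HC : skolem_closed H) :
  G `<=` H -> elementary (reduced_power GC) (reduced_power HC).
Proof.
move=> GH; split=> [_ [f Gf <-]|phi w /reduced_power_assignment[v Gv ->]].
  by exists f => //; exact: GH.
by rewrite !Los // => n; exact: GH.
Qed.

Definition constants : set (nat -> T) := [set (fun=> a) | a in dom M].

Lemma constants_closed : skolem_closed constants.
Proof.
split=> [_ [a Da <-] //|a Da|phi k v cv]; first by exists a.
exists (skolem phi (mkseq (v^~ 0) k)); first exact: skolem_dom.
apply/funext => j; congr skolem; apply: eq_map => n.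
by have [a _ <-] := cv n.
Qed.

Lemma isomorphic_constants : isomorphic M (reduced_power constants_closed).
Proof.
exists (fun a => repr (fun=> a)); split=> //=.
- split=> [a Da|a b _ _ /repr_eq ab|_ [_ [a Da <-] <-]].
  + by exists (fun=> a) => //; exists a.
  + by have [j] := @filter_ex _ W _ _ ab.
  + by exists a.
- by move=> a Da; rewrite repr_succ.
- by move=> a b Da Db; rewrite repr_add.
- by move=> a b Da Db; rewrite repr_mul.
Qed.

End Ultrapower.

Arguments reduced_power {T M} W {W_ultra G} GC.

(** * Squares of infinite sets *)

Lemma card_le_of T U (A : set T) (B : set U) (f : T -> U) :
  (forall a, A a -> B (f a)) ->
  (forall a a', A a -> A a' -> f a = f a' -> a = a') -> A #<= B.
Proof.
move=> AB fI.
have [g] : $| {injfun A >-> B} |.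
  by apply/injfunPex; exists f => // a a'; rewrite !inE; exact: fI.
exact: inj_card_le g.
Qed.

Lemma card_leE T (U : pointedType) (A : set T) (B : set U) : A #<= B ->
  exists f : T -> U, (forall a, A a -> B (f a)) /\
    (forall a a', A a -> A a' -> f a = f a' -> a = a').
Proof.
move=> /pcard_leP/injfunPex[f fAB fI]; exists f; split=> // a a' Aa Aa'.
by apply: fI; rewrite inE.
Qed.

(** A maximal partial injection from [A] to [B] is total or onto. *)
Lemma card_le_total (T U : pointedType) (A : set T) (B : set U) :
  A #<= B \/ B #<= A.
Proof.
pose P (R : set (T * U)) :=
  (forall u, R u -> A u.1 /\ B u.2) /\
  (forall u v, R u -> R v -> u.1 = v.1 <-> u.2 = v.2).
have [|R [[RAB Rinj] Rmax]] := @Zorn_bigcup _ P.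
  move=> F FP Ftot; split=> [u [R FR Ru]|u v [R FR Ru] [R' FR' Rv]].
    exact: (FP _ FR).1.
  have [RR|RR] := Ftot _ _ FR FR'.
    exact: (FP _ FR').2 (RR _ Ru) Rv.
  exact: (FP _ FR).2 Ru (RR _ Rv).
have [AR|/existsNP[a /not_implyP[Aa aR]]] :=
    EM (forall a, A a -> exists b, R (a, b)).
  have /choice[f fP] a : exists b, A a -> R (a, b).
    by have [/AR[b]|] := EM (A a); [exists b|exists point].
  left; apply: (@card_le_of _ _ _ _ f) => [a /fP/RAB[]//|a a' /fP Ra /fP Ra'].
  by move=> ff; apply/(Rinj _ _ Ra Ra').
have [BR|/existsNP[b /not_implyP[Bb bR]]] :=
    EM (forall b, B b -> exists a, R (a, b)).
  have /choice[f fP] b : exists a, B b -> R (a, b).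
    by have [/BR[a']|] := EM (B b); [exists a'|exists point].
  right; apply: (@card_le_of _ _ _ _ f) => [b /fP/RAB[]//|b b' /fP Rb /fP Rb'].
  by move=> ff; apply/(Rinj _ _ Rb Rb').
case: (Rmax (R `|` [set (a, b)])).
  split; first by move=> u Ru; left.
  by move=> /(_ (a, b)) Rab; apply: aR; exists b; apply: Rab; right.
split=> [u [/RAB //|-> //]|[t u] [t' u'] [R1|[-> ->]] [R2|[-> ->]] //=].
- exact: (Rinj _ _ R1 R2).
- by split=> e; [case: aR|case: bR]; [exists u; rewrite -e|exists t; rewrite -e].
- by split=> e; [case: aR|case: bR]; [exists u'; rewrite e|exists t'; rewrite e].
Qed.

Section Squares.
Variable S : pointedType.
Implicit Types (X A : set S) (f : S -> S -> S).

Definition pairing A f := (forall a b, A a -> A b -> A (f a b)) /\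
  (forall a b a' b', A a -> A b -> A a' -> A b' ->
     f a b = f a' b' -> a = a' /\ b = b').

Lemma pairing_transfer X A f u : pairing A f -> A `<=` X ->
  (forall x, X x -> A (u x)) ->
  (forall x y, X x -> X y -> u x = u y -> x = y) ->
  pairing X (fun x y => f (u x) (u y)).
Proof.
move=> [fA fI] AX uA uI; split=> [x y Xx Xy|x y x' y' Xx Xy Xx' Xy' e].
  by apply/AX/fA; exact: uA.
by have [/uI-> // /uI->] := fI _ _ _ _ (uA _ Xx) (uA _ Xy) (uA _ Xx') (uA _ Xy') e.
Qed.

(** The set [pp_set] is required to have two points, which serve as tags in
the extension of a pairing. *)
Record partial_pairing X := PartialPairing {
  pp_set : set S;
  pp_fun : S -> S -> S;
  pp_sub : pp_set `<=` X;
  pp_inf : exists a b, [/\ pp_set a, pp_set b & a <> b];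
  pp_pairing : pairing pp_set pp_fun }.

Definition pp_le X (s t : partial_pairing X) : bool :=
  `[< pp_set s `<=` pp_set t /\
      forall a b, pp_set s a -> pp_set s b -> pp_fun s a b = pp_fun t a b >].

Lemma partial_pairing_exists X : infinite_set X -> inhabited (partial_pairing X).
Proof.
move=> /infiniteP/card_leE[i [iX iI]].
have {}iI : injective i by move=> m n; apply: iI.
have [j [_ jI]] : exists j : nat * nat -> nat,
    (forall a, [set: nat * nat] a -> [set: nat] (j a)) /\
    (forall a a', [set: nat * nat] a -> [set: nat * nat] a' -> j a = j a' -> a = a').
  by apply: card_leE; have := card_nat2; rewrite card_eq_le => /andP[].
have /choice[r rP] a : exists n, range i a -> i n = a.
  by have [[n _ <-]|] := EM (range i a); [exists n|exists 0].
have ri n : r (i n) = n by apply: iI; exact: rP.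
constructor; apply: (@PartialPairing X (range i) (fun a b => i (j (r a, r b)))).
- by move=> _ [n _ <-]; exact: iX.
- exists (i 0), (i 1); split; [by exists 0|by exists 1|by move/iI].
- split=> [a b _ _|_ _ _ _ [a _ <-] [b _ <-] [a' _ <-] [b' _ <-]]; first by eexists.
  by rewrite !ri => /iI e; have [-> ->] := jI _ _ I I e.
Qed.

(** Take a maximal pairing on a subset [A] of [X].  The complement of [A] does
not contain a copy of [A]: four copies of the square of [A], distinguished by
tags, fit into [A], so the pairing would extend to that copy.  Therefore the
complement embeds into [A], and [X] embeds into two tagged copies of [A]. *)
Lemma exists_pairing X : infinite_set X -> exists f, pairing X f.
Proof.
move=> /partial_pairing_exists[t0].
have [s|r s t /asboolP[rs rsf] /asboolP[st stf]|F Ftot|m mmax] :=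
    @ZL_preorder _ t0 (@pp_le X).
- by apply/asboolP; split.
- apply/asboolP; split=> [|a b ra rb]; first exact: subset_trans st.
  by rewrite rsf // stf //; exact: rs.
- have [F0|/set0P F0] := eqVneq F set0; first by exists t0 => s; rewrite F0.
  pose A := \bigcup_(s in F) pp_set s.
  have /choice[fn fnP] (u : S * S) : exists c, forall s, F s -> pp_set s u.1 ->
      pp_set s u.2 -> c = pp_fun s u.1 u.2.
    have [[s [Fs s1 s2]]|ns] :=
      EM (exists s, [/\ F s, pp_set s u.1 & pp_set s u.2]); last first.
      by exists point => s Fs s1 s2; case: ns; exists s.
    exists (pp_fun s u.1 u.2) => t Ft t1 t2.
    by case: (Ftot s t Fs Ft) => /asboolP[_ ->].
  have two s t : F s -> F t -> exists r, [/\ F r, pp_set s `<=` pp_set r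
      & pp_set t `<=` pp_set r].
    move=> Fs Ft; case: (Ftot s t Fs Ft) => /asboolP[st _]; [exists t|exists s];
      by split=> //; exact: subset_refl.
  have AX : A `<=` X by move=> a [s _ /pp_sub].
  have Ainf : exists a b, [/\ A a, A b & a <> b].
    have [s Fs] := F0; have [a [b [sa sb ab]]] := pp_inf s.
    by exists a, b; split=> //; exists s.
  have Apair : pairing A (fun a b => fn (a, b)).
    split=> [a b [s Fs sa] [t Ft tb]|a b a' b' [s Fs sa] [t Ft tb] [s' Fs' sa'] [t' Ft' tb']].
      have [r [Fr sr tr]] := two _ _ Fs Ft.
      exists r => //; rewrite (fnP (a, b) r) //=; [|exact: sr|exact: tr].
      by apply: (pp_pairing r).1; [exact: sr|exact: tr].
    have [r [Fr /(_ _ sa) ra /(_ _ tb) rb]] := two _ _ Fs Ft.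
    have [r' [Fr' /(_ _ sa') ra' /(_ _ tb') rb']] := two _ _ Fs' Ft'.
    have [q [Fq rq rq']] := two _ _ Fr Fr'.
    rewrite (fnP (a, b) q) ?(fnP (a', b') q) //=; try by [apply: rq|apply: rq'].
    by apply: (pp_pairing q).2; by [apply: rq|apply: rq'].
  exists (PartialPairing AX Ainf Apair) => s Fs; apply/asboolP; split=> /=.
    by move=> a sa; exists s.
  by move=> a b sa sb; rewrite (fnP (a, b) s).
have [a1 [a2 [m1 m2 a12]]] := pp_inf m.
have mX := pp_sub (p := m); have [mA mI] := pp_pairing m.
set A := pp_set m in m1 m2 mX mA mI; set f := pp_fun m in mA mI.
pose tag x := if pselect (A x) is left _ then a1 else a2.
have tagA x : A (tag x) by rewrite /tag; case: pselect.
(* a copy of [A] outside [A] would let the pairing be extended *)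
have noext : ~ (A #<= (X `\` A)).
  move=> /card_leE[g [gX gI]].
  have /choice[h0 h0P] x : exists a, (g @` A) x -> A a /\ g a = x.
    by have [[a Aa <-]|] := EM ((g @` A) x); [exists a|exists point].
  pose h x := if pselect (A x) is left _ then x else h0 x.
  pose A' := A `|` g @` A.
  have hA x : A' x -> A (h x).
    by rewrite /h => -[Ax|/h0P[]]; case: pselect.
  have thI x y : A' x -> A' y -> tag x = tag y -> h x = h y -> x = y.
    rewrite /tag /h => A'x A'y; case: pselect => Ax; case: pselect => Ay //;
      try by move=> e; case: a12.
    by case: A'x A'y => [//|/h0P[_ {2}<-]] [//|/h0P[_ {2}<-]] _ ->.
  pose f' x y := if pselect (A x /\ A y) is left _ then f x y
                 else g (f (f (tag x) (tag y)) (f (h x) (h y))).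
  have inA x y : A' x -> A' y -> A (f (f (tag x) (tag y)) (f (h x) (h y))).
    by move=> A'x A'y; apply: (mA); apply: (mA) => //; exact: hA.
  have A'X : A' `<=` X by move=> x [/mX|[a /gX[Xx _] <-]].
  have A'inf : exists a b, [/\ A' a, A' b & a <> b].
    by exists a1, a2; split=> //; left.
  have A'pair : pairing A' f'.
    split=> [x y A'x A'y|x y x' y' A'x A'y A'x' A'y'].
      rewrite /f'; case: pselect => [[Ax Ay]|_]; first by left; exact: mA.
      by right; exists (f (f (tag x) (tag y)) (f (h x) (h y))) => //; exact: inA.
    rewrite /f'; case: pselect => [[Ax Ay]|_]; case: pselect => [[Ax' Ay']|_].
    - exact: mI.
    - by move=> e; have [_] := gX _ (inA _ _ A'x' A'y'); rewrite -e; case; exact: mA.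
    - by move=> e; have [_] := gX _ (inA _ _ A'x A'y); rewrite e; case; exact: mA.
    move=> /gI; move=> /(_ (inA _ _ A'x A'y) (inA _ _ A'x' A'y')).
    move=> /mI[]; try by apply: mA => //; exact: hA.
    by move=> /mI[]// tx ty /mI[]; try exact: hA; move=> hx hy; split; exact: thI.
  have mle : pp_le m (PartialPairing A'X A'inf A'pair).
    apply/asboolP; split=> /=; first by move=> a; left.
    by move=> a b Aa Ab; rewrite /f'; case: pselect => // -[].
  have /asboolP[/(_ (g a1)) /= Ag _] := mmax _ mle.
  by have [_ []] := gX _ m1; apply: Ag; right; exists a1.
have [//|/card_leE[g [gA gI]]] := card_le_total A (X `\` A).
pose u x := f (tag x) (if pselect (A x) is left _ then x else g x).
exists (fun x y => f (u x) (u y)).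
have gA' x : X x -> A (if pselect (A x) is left _ then x else g x).
  by move=> Xx; case: pselect => // nAx; exact: gA.
apply: (@pairing_transfer X A f u) => // [x Xx|x y Xx Xy].
  by apply: mA => //; exact: gA'.
move=> /mI[] //; try exact: gA'.
rewrite /tag; case: pselect => Ax; case: pselect => Ay //;
  try by move=> e; case: a12.
by move=> _ /gI; apply.
Qed.

(** A list is coded by its length together with an iterated pair of its
entries. *)
Lemma card_nat_seq X : infinite_set X ->
  [set p : nat * seq S | forall y, y \in p.2 -> X y] #<= X.
Proof.
move=> infX; have [f [fX fI]] := exists_pairing infX.
have /infiniteP/card_leE[i [iX iI]] := infX.
pose code s := foldr f (i 0) s.
have codeX s : (forall y, y \in s -> X y) -> X (code s).
  elim: s => [_|y s IH sX] /=; first exact: iX.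
  apply: fX; first by apply: sX; rewrite mem_head.
  by apply: IH => z zs; apply: sX; rewrite inE zs orbT.
have codeI s s' : (forall y, y \in s -> X y) -> (forall y, y \in s' -> X y) ->
    size s = size s' -> code s = code s' -> s = s'.
  elim: s s' => [|y s IH] [|y' s'] //= sX s'X [ss] /fI.
  have sX1 z : z \in s -> X z by move=> zs; apply: sX; rewrite inE zs orbT.
  have s'X1 z : z \in s' -> X z by move=> zs; apply: s'X; rewrite inE zs orbT.
  move=> [||||-> /IH ->] //; try exact: codeX.
  - by apply: sX; rewrite mem_head.
  - by apply: s'X; rewrite mem_head.
apply: (@card_le_of _ _ _ _ (fun p => f (i p.1) (f (i (size p.2)) (code p.2)))).
  move=> [n s] /= sX; apply: (fX); first exact: iX.
  by apply: fX; [exact: iX|exact: codeX].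
move=> [n s] [n' s'] /= sX s'X /fI[]; try exact: iX; try by apply: fX; [exact: iX|exact: codeX].
move=> /iI -> // /fI[]; try exact: iX; try exact: codeX.
by move=> /iI ss /codeI ->//; exact: ss.
Qed.

End Squares.

Lemma countable_range T (d : T) (A : set T) : countable A ->
  exists e : nat -> T, (forall n, A (e n) \/ e n = d) /\ A `<=` range e.
Proof.
move=> /countable_injP[f fI].
have /choice[e eP] n : exists a, (exists2 a', A a' & f a' = n) ->
    A a /\ f a = n.
  by have [[a Aa <-]|] := EM (exists2 a', A a' & f a' = n); [exists a|exists d].
pose e' n := if pselect (exists2 a', A a' & f a' = n) is left _ then e n else d.
exists e'; split=> [n|a Aa].
  by rewrite /e'; case: pselect => [/eP[]|]; [left|right].
have fa : exists2 a', A a' & f a' = f a by exists a.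
exists (f a) => //; rewrite /e'; case: pselect => // _.
by have [Ae fe] := eP _ fa; apply: fI; rewrite ?inE.
Qed.

Lemma countable_nat_seq (S : pointedType) (X : set S) : countable X ->
  countable [set p : nat * seq S | forall y, y \in p.2 -> X y].
Proof.
move=> /(countable_range point)[e [_ eX]].
have /choice[r rP] x : exists n, X x -> e n = x.
  by have [/eX[n _ <-]|] := EM (X x); [exists n|exists 0].
pose F (p : nat * seq nat) := (p.1, map e p.2).
apply: (@card_le_trans _ _ _ (F @` setT)); last first.
  exact: card_le_trans (card_image_le F _) (countableP _).
apply: subset_card_le => -[n s] /= sX; exists (n, map r s) => //.
rewrite /F /= -map_comp map_id_in // => x /sX Xx /=; exact: rP.
Qed.

(** * Skolem hulls *)

(** Terms over generators indexed by [I], evaluated to lists of values so that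
a Skolem function can be applied to finitely many arguments without a nested
inductive type.  [Cst n] refers to the [n]-th sequence of a fixed countable
base. *)
Inductive hull_term (I : Type) :=
  | Gen of I
  | Cst of nat
  | Nil
  | Cat of hull_term I & hull_term I
  | Sk of formula & hull_term I.
Arguments Cst {I}.
Arguments Nil {I}.

Fixpoint term_code (t : term) : GenTree.tree nat :=
  match t with
  | Var n => GenTree.Leaf n
  | Zero => GenTree.Node 0 [::]
  | Succ t => GenTree.Node 1 [:: term_code t]
  | Add t u => GenTree.Node 2 [:: term_code t; term_code u]
  | Mul t u => GenTree.Node 3 [:: term_code t; term_code u]
  end.

Fixpoint term_decode (c : GenTree.tree nat) : term :=
  match c with
  | GenTree.Leaf n => Var n
  | GenTree.Node 1 [:: t] => Succ (term_decode t)
  | GenTree.Node 2 [:: t; u] => Add (term_decode t) (term_decode u)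
  | GenTree.Node 3 [:: t; u] => Mul (term_decode t) (term_decode u)
  | _ => Zero
  end.

Lemma term_codeK : cancel term_code term_decode.
Proof. by elim=> //= [t ->|t -> u ->|t -> u ->]. Qed.

Fixpoint formula_code (phi : formula) : GenTree.tree (GenTree.tree nat) :=
  match phi with
  | Eq t u => GenTree.Node 0 [:: GenTree.Leaf (term_code t); GenTree.Leaf (term_code u)]
  | Bot => GenTree.Node 1 [::]
  | Imp phi psi => GenTree.Node 2 [:: formula_code phi; formula_code psi]
  | All phi => GenTree.Node 3 [:: formula_code phi]
  end.

Fixpoint formula_decode (c : GenTree.tree (GenTree.tree nat)) : formula :=
  match c with
  | GenTree.Node 0 [:: GenTree.Leaf t; GenTree.Leaf u] =>
      Eq (term_decode t) (term_decode u)
  | GenTree.Node 2 [:: phi; psi] => Imp (formula_decode phi) (formula_decode psi)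
  | GenTree.Node 3 [:: phi] => All (formula_decode phi)
  | _ => Bot
  end.

Lemma formula_codeK : cancel formula_code formula_decode.
Proof. by elim=> //= [t u|phi -> psi ->|phi ->]; rewrite ?term_codeK. Qed.

Notation hull_code_type := (GenTree.tree (nat + GenTree.tree (GenTree.tree nat))).

Fixpoint hull_code (t : hull_term nat) : hull_code_type :=
  match t with
  | Gen i => GenTree.Leaf (inl i)
  | Cst n => GenTree.Node n.+3 [::]
  | Nil => GenTree.Node 0 [::]
  | Cat t u => GenTree.Node 1 [:: hull_code t; hull_code u]
  | Sk phi t => GenTree.Node 2 [:: GenTree.Leaf (inr (formula_code phi)); hull_code t]
  end.

Fixpoint hull_decode (c : hull_code_type) : hull_term nat :=
  match c with
  | GenTree.Leaf (inl i) => Gen i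
  | GenTree.Node n.+3 _ => Cst n
  | GenTree.Node 1 [:: t; u] => Cat (hull_decode t) (hull_decode u)
  | GenTree.Node 2 [:: GenTree.Leaf (inr phi); t] =>
      Sk (formula_decode phi) (hull_decode t)
  | _ => Nil
  end.

Lemma hull_codeK : cancel hull_code hull_decode.
Proof. by elim=> //= [t -> u ->|phi t ->]; rewrite ?formula_codeK. Qed.

Definition skeleton (l : nat) : hull_term nat :=
  if unpickle l is Some c then hull_decode c else Nil.

Lemma skeleton_onto t : exists l, skeleton l = t.
Proof.
by exists (pickle (hull_code t)); rewrite /skeleton pickleK hull_codeK.
Qed.

Fixpoint gens I (t : hull_term I) : seq I :=
  match t with
  | Gen i => [:: i]
  | Cst _ | Nil => [::]
  | Cat t u => gens t ++ gens u
  | Sk _ t => gens t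
  end.

Fixpoint rename I I' (r : I -> I') (t : hull_term I) : hull_term I' :=
  match t with
  | Gen i => Gen (r i)
  | Cst n => Cst n
  | Nil => Nil
  | Cat t u => Cat (rename r t) (rename r u)
  | Sk phi t => Sk phi (rename r t)
  end.

Lemma gens_rename I I' (r : I -> I') t : gens (rename r t) = map r (gens t).
Proof. by elim: t => //= t -> u ->; rewrite map_cat. Qed.

Section Hull.
Variables (T : Type) (M : structure T) (base : nat -> nat -> T).
Hypothesis base_dom : forall n j, dom M (base n j).
Hypothesis base_cst : forall a, dom M a -> exists n, base n = fun=> a.

Fixpoint hull_eval I (j : nat) (e : I -> T) (t : hull_term I) : seq T :=
  match t with
  | Gen i => [:: e i]
  | Cst n => [:: base n j]
  | Nil => [::]
  | Cat t u => hull_eval j e t ++ hull_eval j e u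
  | Sk phi t => [:: skolem M phi (hull_eval j e t)]
  end.

Lemma eq_hull_eval (I : eqType) j (e e' : I -> T) t :
  {in gens t, e =1 e'} -> hull_eval j e t = hull_eval j e' t.
Proof.
elim: t => //= [i|t IHt u IHu|phi t IH] ee.
- by rewrite ee ?mem_head.
- by rewrite IHt ?IHu // => i ig; apply: ee; rewrite mem_cat ig ?orbT.
- by rewrite IH.
Qed.

Lemma hull_eval_rename I I' j (r : I -> I') e t :
  hull_eval j e (rename r t) = hull_eval j (e \o r) t.
Proof. by elim: t => //= [t -> u ->|phi t ->]. Qed.

Variables (I : eqType) (e : nat -> I -> T).
Hypothesis e_dom : forall j i, dom M (e j i).

Lemma hull_eval_dom j t i : dom M (nth (zero M) (hull_eval j (e j) t) i).
Proof.
elim: t i => [g|n||t IHt u IHu|phi t IH] [|i] /=; rewrite ?nth_nil //;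
  try exact: dom_zero; try exact: skolem_dom.
- by rewrite nth_cat; case: ifP.
- by rewrite nth_cat; case: ifP.
Qed.

Definition hull (X : set I) : set (nat -> T) :=
  [set f | exists t, (forall i, i \in gens t -> X i) /\
                     forall j, hull_eval j (e j) t = [:: f j]].

Lemma sub_hull X Y : X `<=` Y -> hull X `<=` hull Y.
Proof. by move=> XY f [t [tX tf]]; exists t; split=> // i /tX/XY. Qed.

Lemma hull_gen X x : X x -> hull X (fun j => e j x).
Proof. by move=> Xx; exists (Gen x); split=> // i; rewrite inE => /eqP ->. Qed.

Lemma hull_base X n : hull X (base n).
Proof. by exists (Cst n). Qed.

Lemma hull_closed X : skolem_closed M (hull X).
Proof.
split=> [f [t [_ tf]] j|a /base_cst[n <-]|phi k v vX].
- by have := hull_eval_dom j t 0; rewrite tf.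
- exact: hull_base.
have [t [tX tE]] : exists t, (forall i, i \in gens t -> X i) /\
    forall j, hull_eval j (e j) t = mkseq (v^~ j) k.
  elim: k => [|k [t [tX tE]]]; first by exists Nil.
  have [u [uX uE]] := vX k; exists (Cat t u); split=> [i|j] /=.
    by rewrite mem_cat => /orP[/tX|/uX].
  by rewrite tE uE /mkseq -addn1 iotaD map_cat.
by exists (Sk phi t); split=> // j /=; rewrite tE.
Qed.

(** An element of the hull is given by a skeleton, one of countably many, and
by the finite list [s] of the generators that occur in it. *)
Lemma hull_skeleton X f : hull X f -> exists l (s : seq I),
  [/\ forall i, i \in s -> X i, forall q, q \in gens (skeleton l) -> q < size s
    & forall z j, hull_eval j (fun q => e j (nth z s q)) (skeleton l) = [:: f j]].
Proof.
case=> t [tX tf]; pose s := gens t; pose r i := index i s.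
have [l lE] := skeleton_onto (rename r t); exists l, s; split=> // [q|z j].
  by rewrite lE gens_rename => /mapP[i it ->]; rewrite index_mem.
rewrite lE hull_eval_rename -tf; apply: eq_hull_eval => i it /=.
by rewrite /r nth_index.
Qed.

End Hull.

(** * Generic generators and the family of models *)

Definition bits (x : set nat) : nat -> bool := fun n => `[< x n >].

Lemma bits_inj x y : bits x = bits y -> x = y.
Proof.
move=> xy; apply/funext => n; apply/propext.
have e : `[< x n >] = `[< y n >] := congr1 (@^~ n) xy.
by split=> /asboolP xn; apply/asboolP; move: xn; rewrite e.
Qed.

(** The reals [x] and [s], padded by [z] to the length [k] that the
requirements expect, lie in distinct buckets at all large levels; the
requirements of one such level [k] then hold at every later stage. *)
Lemma exists_generic_numbers (D : nat -> nat -> seq nat -> set nat) :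
  exists gen : nat -> set nat -> nat,
    forall l x z (s : seq (set nat)), x \notin s -> x <> z ->
    exists k m, size s <= k /\ forall j, k <= j ->
      ~ forall i, i < m -> odd (gen j x %/ 2 ^ i) <->
                           D j l (mkseq (fun q => gen j (nth z s q)) k) i.
Proof.
have /choice[C CP] j := generic_values j
  (fun m l v => bits_sum (bits (D j l v)) m).
exists (fun j x => C j (bucket j (bits x))) => l x z s xs xz.
pose y p := if p is q.+1 then bits (nth z s q) else bits x.
have [k0 k0P] := bucket_separates (size s).+2 y.
pose k := maxn k0 (maxn (size s) l).+1.
have kk0 : k0 <= k by rewrite leq_maxl.
have sk : size s < k by rewrite /k; lia.
have lk : l < k by rewrite /k; lia.
(* all the padding is the single real with index [(size s).+1] *)
pose low q := minn q (size s).
have lowE q : bits (nth z s q) = y (low q).+1.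
  rewrite /low /=; case: (leqP q (size s)) => // /ltnW qs.
  by rewrite !nth_default.
exists k, (precision k); split=> [|j kj same]; first exact: ltnW.
have := CP j k l (bits x) (fun q => bits (nth z s q)) lk kj; case.
- move=> q _; rewrite lowE => /(k0P k kk0 0) xq.
  have {xq}/bits_inj xq : bits x = y (low q).+1 by apply: xq; rewrite /low; lia.
  have [qs|qs] := ltnP (low q) (size s).
    by move/negP: xs; apply; rewrite xq mem_nth.
  by apply: xz; rewrite xq nth_default.
- move=> p q _ _; rewrite !lowE => /(k0P k kk0); apply; rewrite /low; lia.
- rewrite -bits_sum_mod; apply: eq_bits_sum => i im.
  by apply/idP/asboolP => /(same i im).
Qed.

(** Only finitely many digits can be fixed at almost every stage, so the number
of digits on which two sequences are compared may not grow with the stage. *)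
Lemma ultra_forall (W : set_system nat) {W_ultra : UltraFilter W}
    (P : nat -> nat -> Prop) m :
  (forall i, W [set j | P i j]) -> W [set j | forall i, i < m -> P i j].
Proof.
move=> WP; elim: m => [|m IH]; first by apply: filterS filterT.
apply: filterS (filterI IH (WP m)) => j /= [Pj Pm] i.
by rewrite ltnS leq_eqVlt => /orP[/eqP ->|/Pj].
Qed.

Section Family.
Variables (T : Type) (M : structure T).
Hypothesis PA : models_PA M.
Variable base : nat -> nat -> T.
Hypothesis base_dom : forall n j, dom M (base n j).
Hypothesis base_cst : forall a, dom M a -> exists n, base n = fun=> a.
Variable W : set_system nat.
Context {W_ultra : UltraFilter W}.
Hypothesis W_oo : \oo `<=` W.

Lemma exists_generic_generators : exists gen : nat -> set nat -> nat,
  forall x Y f, hull M base (fun j y => numeral M (gen j y)) Y f -> ~ Y x ->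
    ~ forall i, W [set j | bit1 M (numeral M (gen j x)) i] <->
                W [set j | bit1 M (f j) i].
Proof.
pose D j l (v : seq nat) : set nat :=
  [set i | bit1 M (head (zero M)
     (hull_eval M base j (fun q => numeral M (nth 0 v q)) (skeleton l))) i].
have [gen genP] := exists_generic_numbers D; exists gen => x Y f.
move=> /hull_skeleton[l [s [sY sl sf]]] nYx same.
have xs : x \notin s by apply/negP => /sY.
(* The complement of [x] serves as the padding. *)
have xz : x <> ~` x.
  move=> /(congr1 (@^~ 0)) e.
  have nx0 : ~ x 0 by move=> h; have := h; rewrite e; apply.
  by apply: (nx0); rewrite e.
have [k [m [sk kP]]] := genP l x (~` x) s xs xz.
have Wsame : W [set j | forall i, i < m ->
    (bit1 M (numeral M (gen j x)) i <-> bit1 M (f j) i)].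
  by apply: ultra_forall => i; exact: ultra_iff (same i).
have Wk : W [set j | k <= j] by apply: W_oo; exists k.
have [j [/= samej kj]] := @filter_ex _ W _ _ (filterI Wsame Wk).
apply: (kP j kj) => i /samej; rewrite bit1_numeral // => ->.
rewrite /D /=; suff -> : hull_eval M base j (fun q => numeral M (nth 0
   (mkseq (fun q => gen j (nth (~` x) s q)) k) q)) (skeleton l) = [:: f j] by [].
rewrite -(sf (~` x)); apply: eq_hull_eval => q /sl qs.
by rewrite nth_mkseq // (leq_trans qs).
Qed.

(** The digits stabilize to [b], and the leading digit [2 ^ j] keeps the class
of the sequence nonstandard even if [b] is finite. *)
Definition padded_code (b : set nat) (j : nat) : T :=
  numeral M (2 ^ j * 1 + bits_sum (bits b) j).

(** The sequence is strictly increasing, whereas [W] contains no finite set. *)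
Lemma padded_code_unbounded b a : ~ ae_eq W (padded_code b) (fun=> a).
Proof.
move=> ba; have [j ja] := @filter_ex _ W _ _ ba.
have Wj : W [set j' | j < j'] by apply: W_oo; exists j.+1.
have [j' [/= j'a jj']] := @filter_ex _ W _ _ (filterI ba Wj).
move: ja; rewrite /= -j'a => /(numeral_inj PA).
have := bits_sum_lt (bits b) j.
have : 2 ^ j.+1 <= 2 ^ j' by rewrite leq_exp2l.
rewrite expnS; lia.
Qed.

Lemma padded_code_trace b :
  [set i | W [set j | bit1 M (padded_code b j) i]] = b.
Proof.
have Wi i : W [set j | i < j] by apply: W_oo; exists i.+1.
apply/seteqP; split=> i /=.
  move=> Wb; have [j [/= + ij]] := @filter_ex _ W _ _ (filterI Wb (Wi i)).
  by rewrite /padded_code coded_set_numeral // => /asboolP.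
move=> bi; apply: filterS (Wi i) => j ij /=.
by rewrite /padded_code coded_set_numeral //; exact/asboolP.
Qed.

Variable gen : nat -> set nat -> nat.
Notation e := (fun j y => numeral M (gen j y)).
Hypothesis gen_generic : forall x Y f, hull M base e Y f -> ~ Y x ->
  ~ forall i, W [set j | bit1 M (numeral M (gen j x)) i] <->
              W [set j | bit1 M (f j) i].

Lemma e_dom j y : dom M (e j y).
Proof. exact: numeral_dom. Qed.

Definition family (X : set (set nat)) : structure (nat -> T) :=
  reduced_power W (hull_closed base_dom base_cst e_dom X).

Definition trace (f : nat -> T) : set nat := [set i | W [set j | bit1 M (f j) i]].

Lemma coded_set_family X f : hull M base e X f ->
  coded_set (family X) (repr M W f) = trace f.
Proof. by move=> Xf; apply/funext => i; apply/propext; exact: bit1_reduced_power. Qed.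

Lemma SSy_familyE X Z : SSy (family X) Z -> exists2 f, hull M base e X f & Z = trace f.
Proof.
by move=> [_ [[f Xf <-] _ ->]]; exists f => //; exact: coded_set_family.
Qed.

Lemma trace_in_SSy X f : hull M base e X f ->
  (forall n, ~ ae_eq W f (fun=> numeral M n)) -> SSy (family X) (trace f).
Proof.
move=> Xf nst; exists (repr M W f); split; first exact: imageP.
  by move=> [n _]; rewrite numeral_reduced_power => /esym/repr_eq/nst.
by rewrite coded_set_family.
Qed.

Definition generic x : set nat := trace (fun j => e j x).

Lemma generic_not_in_hull x Y f : hull M base e Y f -> trace f = generic x -> Y x.
Proof.
move=> Yf fx; apply: contrapT => nYx; apply: (gen_generic Yf nYx) => i.
by have := congr1 (@^~ i) fx; rewrite /generic /trace /= => ->.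
Qed.

(** A standard generator would give [generic x] a second code in the hull of the
empty set, so all generators are nonstandard. *)
Lemma generic_in_SSy X x : SSy (family X) (generic x) <-> X x.
Proof.
split=> [/SSy_familyE[f Xf /esym]|Xx]; first exact: generic_not_in_hull.
apply: trace_in_SSy; first exact: (hull_gen M base e).
move=> n xn; have [k kn] := base_cst (numeral_dom M n).
have := @hull_base _ M base _ e set0 k; rewrite kn => /generic_not_in_hull.
move=> /(_ x); apply; apply/seteqP; split=> i /=; apply: filterS2 xn => j /= ->//.
Qed.

Lemma family_elementary X Y : X `<=` Y -> elementary (family X) (family Y).
Proof. by move=> XY; apply: elementary_reduced_power; exact: sub_hull. Qed.

Lemma SSy_sub_of_elementary X Y :
  elementary (family X) (family Y) -> SSy (family X) `<=` SSy (family Y).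
Proof.
move=> [dXY _] Z [_ [[f Xf <-] nst ->]].
have [g Yg gf] := dXY _ (imageP _ Xf).
exists (repr M W f); split; first exact: dXY (imageP _ Xf).
  by move=> [n _]; rewrite numeral_reduced_power => nf; apply: nst; exists n => //;
    rewrite numeral_reduced_power.
rewrite -{2}gf !coded_set_family //; apply/seteqP; move/repr_eq: gf => gf.
by split=> i /=; apply: filterS2 gf => j /= ->.
Qed.

Lemma sub_of_SSy_sub X Y : SSy (family X) `<=` SSy (family Y) -> X `<=` Y.
Proof. by move=> XY x /generic_in_SSy/XY/generic_in_SSy. Qed.

Lemma padded_code_in_SSy X b : (exists n, base n = padded_code b) ->
  SSy (family X) b.
Proof.
move=> [n bn]; rewrite -[b]padded_code_trace; apply: trace_in_SSy.
  by rewrite -bn; exact: hull_base.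
by move=> m; exact: padded_code_unbounded.
Qed.

Hypothesis base_singleton : forall n, exists k, base k = padded_code [set n].

(** The code of a singleton is not the class of a constant sequence. *)
Lemma family_proper X : proper_elementary (reduced_power W (constants_closed M)) (family X).
Proof.
split.
  by apply: elementary_reduced_power => _ [a /base_cst[n <-] <-]; exact: hull_base.
have [k bk] := base_singleton 0.
have : dom (family X) (repr M W (base k)) by apply: imageP; exact: hull_base.
move=> + same; rewrite -same bk => -[_ [a _ <-] /esym/repr_eq].
exact: padded_code_unbounded.
Qed.

Lemma card_nat_SSy X : [set: nat] #<= SSy (family X).
Proof.
apply: (@card_le_of _ _ _ _ (fun n => [set n])) => [n _|m n _ _ mn].
  exact: padded_code_in_SSy.
by have : [set n] m by rewrite -mn.
Qed.

Lemma card_X_SSy X : X #<= SSy (family X).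
Proof.
apply: (@card_le_of _ _ _ _ generic) => [x /generic_in_SSy//|x y Xx Xy xy].
by apply/esym/(@generic_not_in_hull y [set x] _ _ xy)/(hull_gen M base e).
Qed.

Lemma card_SSy_dom X : SSy (family X) #<= dom (family X).
Proof.
apply: card_le_trans (card_image_le (coded_set (family X)) _).
by apply: subset_card_le => _ [b [Db _ ->]]; exists b.
Qed.

Lemma card_dom_nat_seq X : dom (family X) #<=
  [set p : nat * seq (set nat) | forall y, y \in p.2 -> X y].
Proof.
pose F (p : nat * seq (set nat)) := repr M W (fun j => head (zero M)
  (hull_eval M base j (fun q => e j (nth set0 p.2 q)) (skeleton p.1))).
apply: card_le_trans (card_image_le F _); apply: subset_card_le => _ [f Xf <-].
have [l [s [sX _ sf]]] := hull_skeleton Xf.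
by exists (l, s) => //; congr repr; apply/funext => j; rewrite sf.
Qed.

Lemma card_family X :
  dom (family X) #= SSy (family X) /\ card_eq_max (SSy (family X)) [set: nat] X.
Proof.
have SD := card_SSy_dom X.
rewrite /card_eq_max; case: ifP => [natX|/negP natX].
  have DX : dom (family X) #<= X.
    by apply: card_le_trans (card_dom_nat_seq X) _; apply/card_nat_seq/infiniteP.
  have XS := card_X_SSy X.
  rewrite !card_eq_le SD XS (card_le_trans DX XS).
  by rewrite (card_le_trans SD DX).
have cX : countable X by apply/finite_set_countable/finite_setPn.
have Dn : dom (family X) #<= [set: nat].
  apply: card_le_trans (card_dom_nat_seq X) _; exact: countable_nat_seq.
have nS := card_nat_SSy X.
by rewrite !card_eq_le SD nS (card_le_trans Dn nS) (card_le_trans SD Dn).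
Qed.

End Family.

Unset Implicit Arguments.

Theorem corollary3p7 (MA : martin_axiom)
  (T : Type) (M : structure T) (M_PA : models_PA M)
  (M_countable : countable (dom M)) (M_nonstandard : nonstandard M)
  (A : set (set nat)) (A_small : card_lt A continuum)
  (B : set (set nat)) (B_countable : countable B)
  (disjAB : generated_turing_ideal (SSy M `|` B) `&` A = set0) :
  exists (U : Type) (M' : structure U) (N : set (set nat) -> structure U),
    isomorphic M M' /\
    (forall X : set (set nat),
       [/\ proper_elementary M' (N X),
           B `<=` SSy (N X),
           dom (N X) #= SSy (N X) &
           card_eq_max (SSy (N X)) [set: nat] X]) /\
    (forall X Y : set (set nat),
       (X `<=` Y <-> elementary (N X) (N Y)) /\
       (elementary (N X) (N Y) <-> SSy (N X) `<=` SSy (N Y))).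
Proof.
have [W [W_ultra W_oo]] := @ultraFilterLemma _ \oo _.
have [a [aP aM]] := countable_range (zero M) M_countable.
have [b [_ bB]] := countable_range set0 B_countable.
have Da n : dom M (a n) by case: (aP n) => [//|->]; exact: dom_zero.
(* The base interleaves the constants, the codes of singletons and those of [B]. *)
pose base n : nat -> T := let m := n./2 in
  if odd n then padded_code M (if odd m then [set m./2] else b m./2)
  else fun=> a m.
have base_dom n j : dom M (base n j).
  by rewrite /base; case: odd => //; exact: numeral_dom.
have base_cst c : dom M c -> exists n, base n = fun=> c.
  by move=> /aM[n _ <-]; exists n.*2; rewrite /base odd_double doubleK.
have oddS m : odd m.*2.+1 by rewrite /= odd_double.
have halfS m : m.*2.+1./2 = m by exact: uphalf_double.
have base_singleton n : exists k, base k = padded_code M [set n].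
  by exists n.*2.+1.*2.+1; rewrite /base !(oddS, halfS).
have base_B c : B c -> exists n, base n = padded_code M c.
  move=> /bB[n _ <-]; exists n.*2.*2.+1.
  by rewrite /base oddS !halfS odd_double doubleK.
have [gen gen_generic] := exists_generic_generators M_PA base W_oo.
exists (nat -> T), (reduced_power W (constants_closed M)),
  (family (W := W) base_dom base_cst gen).
split; first exact: isomorphic_constants.
split=> [X|X Y].
  have [DS SX] := card_family M_PA base_dom base_cst W_oo gen_generic base_singleton X.
  split=> //; first exact: family_proper.
  by move=> c /base_B; exact: padded_code_in_SSy.
have SSy_sub := @sub_of_SSy_sub _ _ _ base_dom base_cst _ _ _ gen_generic.
split; split.
- exact: family_elementary.
- by move=> /SSy_sub_of_elementary; exact: SSy_sub.
- exact: SSy_sub_of_elementary.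
- by move=> /SSy_sub; exact: family_elementary.
Qed.
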